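(* (ZF, without the Axiom of Choice.) The following statements are equivalent: (a) $cf(\omega_1)=\omega_1$; (b) $\omega_1\to(\omega_1,\omega+1)$; (c) $Regressive(\omega_1,\omega_1)$; (d) ${[\omega_1]}^{<\omega}\to\Delta(\omega_1)$.
   Context: The base theory is ZF. Cardinals are initial ordinals. $\omega_1\to(\omega_1,\omega+1)$ means: for every $f:[\omega_1]^2\to 2$ there is either a set $H\subset\omega_1$ of order type $\omega_1$ with $f$ constantly $0$ on $[H]^2$, or a set $H\subset\omega_1$ of order type $\omega+1$ with $f$ constantly $1$ on $[H]^2$. For cardinals $\mu,\lambda\in On$, $Regressive(\mu,\lambda)$ means: for each regressive function $f:\mu\to\mu$ (i.e. $f(\alpha)<\alpha$ for all $0<\alpha<\mu$) there is $\alpha<\mu$ such that $|f^{-1}\{\alpha\}|\ge\lambda$. For infinite cardinals $\mu,\lambda$, ${[\mu]}^{<\omega}\to\Delta(\lambda)$ means: every family $\mathcal A$ of finite sets of ordinals with $|\mathcal A|=\mu$ contains a $\Delta$-system $\mathcal B\subset\mathcal A$ with $|\mathcal B|=\lambda$ (a $\Delta$-system is a family for which there is a set $D$, the kernel, such that $A\cap B=D$ for all distinct members $A,B$). *)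

(* Defs.v *)
(** ** First-order ZF and its models

    A theorem of ZF is rendered as a fact holding in every model of the
    first-order theory ZF.  The schemas of Separation and Replacement range
    only over properties definable by first-order formulas with parameters:
    were they to range over arbitrary predicates, choice principles of the
    meta-theory would be inherited by the models. *)

Record structure : Type := Structure {
  carrier :> Type;
  mem : carrier -> carrier -> Prop
}.
Arguments mem {s} x y.

Notation "x ∈ y" := (mem x y) (at level 70, no associativity).
Notation "x ∉ y" := (~ mem x y) (at level 70, no associativity).

(** Formulas of the language {∈, =}, with de Bruijn indices. *)
Inductive formula : Type :=
| FMem (i j : nat)
| FEq (i j : nat)
| FFalse
| FImp (p q : formula)
| FAnd (p q : formula)
| FOr (p q : formula)
| FAll (p : formula)
| FEx (p : formula).

Definition scons {T : Type} (x : T) (rho : nat -> T) (n : nat) : T :=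
  match n with O => x | S m => rho m end.

Fixpoint sat {M : structure} (rho : nat -> M) (p : formula) : Prop :=
  match p with
  | FMem i j => rho i ∈ rho j
  | FEq i j => rho i = rho j
  | FFalse => False
  | FImp p q => sat rho p -> sat rho q
  | FAnd p q => sat rho p /\ sat rho q
  | FOr p q => sat rho p \/ sat rho q
  | FAll p => forall x : M, sat (scons x rho) p
  | FEx p => exists x : M, sat (scons x rho) p
  end.

(** All quantifiers in the definitions below range over the model (or over the
    parameters just above), so each of them is the interpretation in the model
    of a first-order formula of set theory.  Sets such as [∅], [{x, y}] or
    [x ∪ {x}] are handled through their defining property. *)

Definition Subset {M : structure} (x y : M) : Prop :=
  forall z, z ∈ x -> z ∈ y.

Definition IsEmpty {M : structure} (x : M) : Prop := forall z, z ∉ x.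

Definition IsUPair {M : structure} (p x y : M) : Prop :=
  forall z, z ∈ p <-> z = x \/ z = y.

Definition IsSucc {M : structure} (x s : M) : Prop :=
  forall z, z ∈ s <-> z ∈ x \/ z = x.

Record ZF (M : structure) : Prop := {
  zf_extensionality :
    forall x y : M, (forall z, z ∈ x <-> z ∈ y) -> x = y;
  zf_foundation :
    forall x : M, (exists y, y ∈ x) ->
      exists y, y ∈ x /\ forall z, z ∈ y -> z ∉ x;
  zf_pairing :
    forall x y : M, exists p, IsUPair p x y;
  zf_union :
    forall x : M, exists u, forall z, z ∈ u <-> exists y, z ∈ y /\ y ∈ x;
  zf_powerset :
    forall x : M, exists p, forall z, z ∈ p <-> Subset z x;
  zf_infinity :
    exists w : M, (exists e, IsEmpty e /\ e ∈ w) /\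
      forall x, x ∈ w -> exists s, IsSucc x s /\ s ∈ w;
  zf_separation :
    forall (p : formula) (rho : nat -> M) (a : M),
      exists b, forall x, x ∈ b <-> x ∈ a /\ sat (scons x rho) p;
  (* index 0 stands for the image y, index 1 for the argument x *)
  zf_replacement :
    forall (p : formula) (rho : nat -> M) (a : M),
      (forall x y y', x ∈ a ->
         sat (scons y (scons x rho)) p -> sat (scons y' (scons x rho)) p ->
         y = y') ->
      exists b, forall y,
        y ∈ b <-> exists x, x ∈ a /\ sat (scons y (scons x rho)) p
}.

(** ** Functions and equinumerosity *)

(** [p] is the Kuratowski pair {{x}, {x, y}}. *)
Definition IsPair {M : structure} (p x y : M) : Prop :=
  forall z, z ∈ p <-> IsUPair z x x \/ IsUPair z x y.

Definition Maps {M : structure} (f x y : M) : Prop :=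
  exists p, IsPair p x y /\ p ∈ f.

Definition IsFun {M : structure} (f a b : M) : Prop :=
  (forall p, p ∈ f -> exists x y, x ∈ a /\ y ∈ b /\ IsPair p x y) /\
  (forall x, x ∈ a -> exists! y, Maps f x y).

Definition IsInj {M : structure} (f a b : M) : Prop :=
  IsFun f a b /\ forall x x' y, Maps f x y -> Maps f x' y -> x = x'.

Definition IsBij {M : structure} (f a b : M) : Prop :=
  IsInj f a b /\ forall y, y ∈ b -> exists x, Maps f x y.

(** |a| = |b| and |a| <= |b|. *)
Definition CardEq {M : structure} (a b : M) : Prop := exists f, IsBij f a b.
Definition CardLe {M : structure} (a b : M) : Prop := exists f, IsInj f a b.

(** ** Ordinals and cardinals *)

Definition Transitive {M : structure} (x : M) : Prop :=
  forall y, y ∈ x -> Subset y x.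

Definition WellOrderedByMem {M : structure} (x : M) : Prop :=
  (forall a, a ∈ x -> a ∉ a) /\
  (forall a b c, a ∈ x -> b ∈ x -> c ∈ x -> a ∈ b -> b ∈ c -> a ∈ c) /\
  (forall a b, a ∈ x -> b ∈ x -> a ∈ b \/ a = b \/ b ∈ a) /\
  (forall s, Subset s x -> (exists a, a ∈ s) ->
     exists m, m ∈ s /\ forall a, a ∈ s -> m = a \/ m ∈ a).

Definition Ordinal {M : structure} (x : M) : Prop :=
  Transitive x /\ WellOrderedByMem x.

(** Nonzero limit ordinals. *)
Definition Limit {M : structure} (x : M) : Prop :=
  Ordinal x /\ (exists y, y ∈ x) /\
  forall y, y ∈ x -> exists s, IsSucc y s /\ s ∈ x.

Definition IsOmega {M : structure} (w : M) : Prop :=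
  Limit w /\ forall n, n ∈ w -> ~ Limit n.

Definition Finite {M : structure} (x : M) : Prop :=
  exists w n, IsOmega w /\ n ∈ w /\ CardEq x n.

(** Initial ordinals. *)
Definition Cardinal {M : structure} (k : M) : Prop :=
  Ordinal k /\ forall a, a ∈ k -> ~ CardEq a k.

(** [k] is the least cardinal greater than ω. *)
Definition IsOmega1 {M : structure} (k : M) : Prop :=
  exists w, IsOmega w /\ Cardinal k /\ w ∈ k /\
    forall c, c ∈ k -> Cardinal c -> w ∉ c.

Definition HasCofinalMap {M : structure} (b a : M) : Prop :=
  exists f, IsFun f b a /\
    forall x, x ∈ a -> exists i y, Maps f i y /\ (x ∈ y \/ x = y).

(** cf(a) = c: the least ordinal mapped cofinally into [a]. *)
Definition IsCf {M : structure} (a c : M) : Prop :=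
  Ordinal c /\ HasCofinalMap c a /\ forall b, b ∈ c -> ~ HasCofinalMap b a.

(** The set of ordinals [h], ordered by ∈, has order type [t]. *)
Definition HasOrderType {M : structure} (h t : M) : Prop :=
  Ordinal t /\
  exists g, IsBij g t h /\
    forall a b x y, Maps g a x -> Maps g b y -> (a ∈ b <-> x ∈ y).

(** ** The combinatorial principles *)

(** [d] is [k]^2, the set of two-element subsets of [k]. *)
Definition IsPairSet {M : structure} (k d : M) : Prop :=
  forall p, p ∈ d <->
    exists x y, x ∈ k /\ y ∈ k /\ x <> y /\ IsUPair p x y.

Definition ConstantOnPairs {M : structure} (f h i : M) : Prop :=
  forall x y p, x ∈ h -> y ∈ h -> x <> y -> IsUPair p x y -> Maps f p i.

(** k -> (s, t) for ordinals k, s, t. *)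
Definition Arrow {M : structure} (k s t : M) : Prop :=
  forall zero one two d f : M,
    IsEmpty zero -> IsSucc zero one -> IsSucc one two ->
    IsPairSet k d -> IsFun f d two ->
    (exists h, Subset h k /\ HasOrderType h s /\ ConstantOnPairs f h zero) \/
    (exists h, Subset h k /\ HasOrderType h t /\ ConstantOnPairs f h one).

Definition Regressive {M : structure} (mu lambda : M) : Prop :=
  forall f : M, IsFun f mu mu ->
    (forall a b, a ∈ mu -> ~ IsEmpty a -> Maps f a b -> b ∈ a) ->
    exists a preim, a ∈ mu /\
      (forall x, x ∈ preim <-> x ∈ mu /\ Maps f x a) /\
      CardLe lambda preim.

Definition IsDeltaSystem {M : structure} (b : M) : Prop :=
  exists d, forall x y, x ∈ b -> y ∈ b -> x <> y ->
    forall z, z ∈ d <-> z ∈ x /\ z ∈ y.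

(** [mu]^{<ω} -> Δ(lambda). *)
Definition DeltaArrow {M : structure} (mu lambda : M) : Prop :=
  forall A : M,
    (forall x, x ∈ A -> Finite x /\ forall a, a ∈ x -> Ordinal a) ->
    CardEq A mu ->
    exists B, Subset B A /\ IsDeltaSystem B /\ CardEq B lambda.

(* Main.v *)
Require Import Defs.
From Stdlib Require Import Classical ClassicalEpsilon.

(** Each principle is shown equivalent to the regularity of ω₁.

    If ω₁ is singular, there is a nondecreasing [K : ω₁ → ω] with bounded
    fibres.  Then [K] itself, made regressive, refutes (c); colouring {x, y} by
    whether [K x = K y] refutes (b), since [K] would embed a 1-homogeneous set
    of type ω + 1 into ω; and the sets {x, K x}, with
    K x replaced by x for x ∈ ω, refute (d).

    If ω₁ is regular, call a set small when all its maps into ω₁ are bounded.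
    Small unions of small sets are small, and so is the set of finite subsets of
    a small set; no choice is needed because bounds are obtained as suprema.
    Hence a map on ω₁ sending each [a] to a finite subset of the union of
    earlier small sets [B c], [c < a], is constant on an unbounded set.  This
    gives (c) with [F a = {f a}]; (d) with [F a] the part of the [a]-th set that
    is covered by the earlier ones, the common value being the kernel; and (b)
    with [F a] the greedily chosen 1-homogeneous subset of [a] whose members are
    all joined to [a] by colour 1: if it is infinite, a set of type ω + 1
    appears, and two points with the same greedy set are joined by colour 0. *)

(** * Definable classes *)

(** The schemas of a model apply only to first-order formulas, so every set formed below has to come
    with a definability proof. Writing formulas by hand is avoided by the semantic notion [Dfn],
    closed under connectives, quantifiers and substitution of definable terms, and by the tactic
    [dfn] that applies these closure properties. The choice operator of the meta-theory only names
    sets that extensionality already determines, so it brings no choice into the model. Singularity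
    yields an index function into ω because it is witnessed by a cofinal map on some [b] below ω₁,
    and a single enumeration of this [b] can be fixed without choice. Under regularity the obstacle
    is that a countable union of countable sets cannot be treated by enumerating all pieces at once.
    Smallness replaces countability because it speaks of all maps and selects none. Finiteness of
    the sets [F a] matters at the limit of the iteration: a finite subset of an increasing union of
    ω stages is contained in one stage, where the bounds on fibres have already been collected. *)

Fixpoint rename (r : nat -> nat) (p : formula) : formula :=
  let up n := match n with O => O | S m => S (r m) end in
  match p with
  | FMem i j => FMem (r i) (r j)
  | FEq i j => FEq (r i) (r j)
  | FFalse => FFalse
  | FImp p q => FImp (rename r p) (rename r q)
  | FAnd p q => FAnd (rename r p) (rename r q)
  | FOr p q => FOr (rename r p) (rename r q)
  | FAll p => FAll (rename up p)
  | FEx p => FEx (rename up p)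
  end.

Lemma sat_rename (M : structure) (p : formula) (r : nat -> nat) (rho sigma : nat -> M) :
  (forall k, rho (r k) = sigma k) -> (sat rho (rename r p) <-> sat sigma p).
Proof.
  revert r rho sigma.
  induction p as [i j|i j| |p IHp q IHq|p IHp q IHq|p IHp q IHq|p IHp|p IHp];
    intros r rho sigma E; simpl.
  - rewrite !E; tauto.
  - rewrite !E; tauto.
  - tauto.
  - rewrite (IHp _ _ _ E), (IHq _ _ _ E); tauto.
  - rewrite (IHp _ _ _ E), (IHq _ _ _ E); tauto.
  - rewrite (IHp _ _ _ E), (IHq _ _ _ E); tauto.
  - split; intros H x; specialize (H x); revert H;
      apply IHp; intros [|k]; simpl; auto.
  - split; intros [x H]; exists x; revert H;
      apply IHp; intros [|k]; simpl; auto.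
Qed.

Lemma sat_ext (M : structure) (p : formula) (rho sigma : nat -> M) :
  (forall k, rho k = sigma k) -> (sat rho p <-> sat sigma p).
Proof.
  intros E.
  rewrite <- (sat_rename M p (fun k => k) sigma rho) by (intros; symmetry; apply E).
  apply sat_rename; reflexivity.
Qed.

Section Definability.
Context {M : structure}.

Definition lookup (rho : nat -> M) (v : nat + M) : M :=
  match v with inl i => rho i | inr c => c end.

(** Each variable of the formula stands, according to [v], either for a
    coordinate of the environment or for a parameter. *)
Definition Dfn (P : (nat -> M) -> Prop) : Prop :=
  exists (p : formula) (v : nat -> nat + M),
    forall rho, P rho <-> sat (fun k => lookup rho (v k)) p.

(** The language has no function symbols, so a term is represented by its graph: the value sits at
    coordinate 0 and the arguments move up by one. *)
Definition Tm (t : (nat -> M) -> M) : Prop :=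
  Dfn (fun rho => rho 0 = t (fun k => rho (S k))).

Definition DF (F : M -> M) : Prop := Dfn (fun rho => rho 0 = F (rho 1)).

Lemma Dfn_iff (P Q : (nat -> M) -> Prop) :
  (forall rho, P rho <-> Q rho) -> Dfn Q -> Dfn P.
Proof.
  intros E (p & v & H). exists p, v. intros rho. rewrite E. apply H.
Qed.

Lemma Dfn_subst (P : (nat -> M) -> Prop) (s : nat -> nat + M) :
  Dfn P -> Dfn (fun rho => P (fun i => lookup rho (s i))).
Proof.
  intros (p & v & H).
  exists p, (fun k => match v k with inl i => s i | inr c => inr c end).
  intros rho. rewrite H. apply sat_ext. intros k. destruct (v k); reflexivity.
Qed.

(** Two formulas come with unrelated assignments of their variables. To combine them, the variables
    of one are moved to the even indices and those of the other to the odd ones. *)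
Fixpoint interleave (u v : nat -> nat + M) (k : nat) : nat + M :=
  match k with O => u 0 | S k' => interleave v (fun n => u (S n)) k' end.

Lemma interleave_even_odd (k : nat) (u v : nat -> nat + M) :
  interleave u v (k + k) = u k /\ interleave u v (S (k + k)) = v k.
Proof.
  revert u v. induction k as [|k IH]; intros u v.
  - split; reflexivity.
  - rewrite <- plus_n_Sm.
    destruct (IH (fun n => u (S n)) (fun n => v (S n))) as [H1 H2].
    split; [exact H1 | exact H2].
Qed.

Lemma Dfn_binary (c : formula -> formula -> formula) (o : Prop -> Prop -> Prop) :
  (forall (rho : nat -> M) p q, sat rho (c p q) <-> o (sat rho p) (sat rho q)) ->
  (forall A A' B B', (A <-> A') -> (B <-> B') -> (o A B <-> o A' B')) ->
  forall P Q, Dfn P -> Dfn Q -> Dfn (fun rho => o (P rho) (Q rho)).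
Proof.
  intros Hc Ho P Q (p & u & Hp) (q & v & Hq).
  exists (c (rename (fun k => k + k) p) (rename (fun k => S (k + k)) q)), (interleave u v).
  intros rho. rewrite Hc. apply Ho; [rewrite Hp | rewrite Hq]; symmetry;
    apply sat_rename; intros k; f_equal; apply interleave_even_odd.
Qed.

Lemma Dfn_and (P Q : (nat -> M) -> Prop) : Dfn P -> Dfn Q -> Dfn (fun rho => P rho /\ Q rho).
Proof. apply (Dfn_binary FAnd and); simpl; tauto. Qed.

Lemma Dfn_or (P Q : (nat -> M) -> Prop) : Dfn P -> Dfn Q -> Dfn (fun rho => P rho \/ Q rho).
Proof. apply (Dfn_binary FOr or); simpl; tauto. Qed.

Lemma Dfn_imp (P Q : (nat -> M) -> Prop) : Dfn P -> Dfn Q -> Dfn (fun rho => P rho -> Q rho).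
Proof. apply (Dfn_binary FImp (fun A B => A -> B)); simpl; tauto. Qed.

(** A proposition that ignores the environment is decided by excluded middle, hence expressed by a
    closed formula, whatever its own form. *)
Lemma Dfn_const (P : Prop) : Dfn (fun _ => P).
Proof.
  destruct (classic P) as [H|H].
  - exists (FImp FFalse FFalse), inl. simpl. tauto.
  - exists FFalse, inl. simpl. tauto.
Qed.

Lemma Dfn_not (P : (nat -> M) -> Prop) : Dfn P -> Dfn (fun rho => ~ P rho).
Proof. intros H. apply Dfn_imp; [exact H | apply Dfn_const]. Qed.

Lemma Dfn_equiv (P Q : (nat -> M) -> Prop) : Dfn P -> Dfn Q -> Dfn (fun rho => P rho <-> Q rho).
Proof. intros HP HQ. apply Dfn_and; apply Dfn_imp; assumption. Qed.

Lemma Dfn_ex (Q : M -> (nat -> M) -> Prop) :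
  Dfn (fun rho => Q (rho 0) (fun k => rho (S k))) -> Dfn (fun rho => exists x, Q x rho).
Proof.
  intros (p & v & H).
  (* Several variables of [p] may stand for the quantified coordinate 0; the renaming merges them
     all into the bound variable, while the others keep their assignment with coordinates lowered by
     one. *)
  exists (FEx (rename (fun k => match v k with inl 0 => 0 | _ => S k end) p)),
    (fun k => match v k with inl (S i) => inl i | w => w end).
  intros rho; simpl.
  assert (E : forall x, Q x rho <-> sat (scons x (fun k => lookup rho
      match v k with inl (S i) => inl i | w => w end))
    (rename (fun k => match v k with inl 0 => 0 | _ => S k end) p)).
  { intros x. change (Q x rho) with (Q (scons x rho 0) (fun k => scons x rho (S k))).
    rewrite H. symmetry. apply sat_rename.
    intros k. destruct (v k) as [[|i]|c] eqn:Ev; simpl; rewrite ?Ev; reflexivity. }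
  split; intros [x Hx]; exists x; apply E, Hx.
Qed.

Lemma Dfn_all (Q : M -> (nat -> M) -> Prop) :
  Dfn (fun rho => Q (rho 0) (fun k => rho (S k))) -> Dfn (fun rho => forall x, Q x rho).
Proof.
  intros H. apply (Dfn_iff _ (fun rho => ~ exists x, ~ Q x rho)).
  - intros rho. split; [intros A [x Hx]; auto|].
    intros A x. apply NNPP. intros B. apply A. exists x. exact B.
  - apply Dfn_not, Dfn_ex, Dfn_not, H.
Qed.

Lemma Tm_var (i : nat) : Tm (fun rho => rho i).
Proof.
  exists (FEq 0 (S i)), inl. intros rho; simpl. tauto.
Qed.

Lemma Tm_const (c : M) : Tm (fun _ => c).
Proof.
  exists (FEq 0 1), (fun k => match k with O => inl 0 | _ => inr c end).
  intros rho; simpl. tauto.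
Qed.

Lemma Tm_rename (t : (nat -> M) -> M) (r : nat -> nat) :
  Tm t -> Tm (fun rho => t (fun k => rho (r k))).
Proof.
  exact (Dfn_subst _ (fun k => match k with O => inl 0 | S k => inl (S (r k)) end)).
Qed.

Lemma Dfn_shift (Q : M -> (nat -> M) -> Prop) :
  Dfn (fun rho => Q (rho 0) (fun k => rho (S k))) ->
  Dfn (fun rho => Q (rho 0) (fun k => rho (S (S k)))).
Proof.
  exact (Dfn_subst _ (fun k => match k with O => inl 0 | S k => inl (S (S k)) end)).
Qed.

Lemma Dfn_rel1 (R : M -> Prop) : Dfn (fun rho => R (rho 0)) ->
  forall t, Tm t -> Dfn (fun rho => R (t rho)).
Proof.
  intros H t Ht. apply (Dfn_iff _ (fun rho => exists x, x = t rho /\ R x)).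
  - intros rho. split; [intros A; exists (t rho); auto | intros (x & -> & A); exact A].
  - apply Dfn_ex. apply Dfn_and; [exact Ht | exact H].
Qed.

Lemma Dfn_rel2 (R : M -> M -> Prop) : Dfn (fun rho => R (rho 0) (rho 1)) ->
  forall t u, Tm t -> Tm u -> Dfn (fun rho => R (t rho) (u rho)).
Proof.
  intros H t u Ht Hu.
  apply (Dfn_iff _ (fun rho => exists x, x = t rho /\ exists y, y = u rho /\ R x y)).
  - intros rho. split; [eauto 6 | intros (x & -> & y & -> & A); exact A].
  - apply Dfn_ex. apply Dfn_and; [exact Ht|].
    apply (Dfn_ex (fun y rho => y = u (fun k => rho (S k)) /\ R (rho 0) y)).
    apply Dfn_and; [exact (Tm_rename u S Hu)|].
    exact (Dfn_subst _ (fun k => match k with O => inl 1 | _ => inl 0 end) H).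
Qed.

Lemma Dfn_rel3 (R : M -> M -> M -> Prop) : Dfn (fun rho => R (rho 0) (rho 1) (rho 2)) ->
  forall t u v, Tm t -> Tm u -> Tm v -> Dfn (fun rho => R (t rho) (u rho) (v rho)).
Proof.
  intros H t u v Ht Hu Hv.
  apply (Dfn_iff _ (fun rho =>
    exists x, x = t rho /\ exists y, y = u rho /\ exists z, z = v rho /\ R x y z)).
  - intros rho. split; [eauto 8 | intros (x & -> & y & -> & z & -> & A); exact A].
  - apply Dfn_ex. apply Dfn_and; [exact Ht|].
    apply (Dfn_ex (fun y rho => y = u (fun k => rho (S k)) /\
      exists z, z = v (fun k => rho (S k)) /\ R (rho 0) y z)).
    apply Dfn_and; [exact (Tm_rename u S Hu)|].
    apply (Dfn_ex (fun z rho => z = v (fun k => rho (S (S k))) /\ R (rho 1) (rho 0) z)).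
    apply Dfn_and; [exact (Tm_rename v (fun k => S (S k)) Hv)|].
    exact (Dfn_subst _ (fun k => match k with O => inl 2 | 1 => inl 1 | _ => inl 0 end) H).
Qed.

Lemma Dfn_mem (t u : (nat -> M) -> M) : Tm t -> Tm u -> Dfn (fun rho => t rho ∈ u rho).
Proof.
  apply (Dfn_rel2 (fun x y => x ∈ y)). exists (FMem 0 1), inl. simpl. tauto.
Qed.

Lemma Dfn_eq (t u : (nat -> M) -> M) : Tm t -> Tm u -> Dfn (fun rho => t rho = u rho).
Proof.
  apply (Dfn_rel2 (fun x y => x = y)). exists (FEq 0 1), inl. simpl. tauto.
Qed.

Lemma Tm_fun1 (F : M -> M) : DF F -> forall t, Tm t -> Tm (fun rho => F (t rho)).
Proof.
  intros H t Ht.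
  exact (Dfn_rel2 (fun y x => y = F x) H _ _ (Tm_var 0) (Tm_rename t S Ht)).
Qed.

Lemma Tm_fun2 (F : M -> M -> M) : Tm (fun rho => F (rho 0) (rho 1)) ->
  forall t u, Tm t -> Tm u -> Tm (fun rho => F (t rho) (u rho)).
Proof.
  intros H t u Ht Hu.
  exact (Dfn_rel3 (fun z x y => z = F x y) H _ _ _ (Tm_var 0)
    (Tm_rename t S Ht) (Tm_rename u S Hu)).
Qed.

Definition cond (P : Prop) (x y : M) : M := if excluded_middle_informative P then x else y.

Lemma cond_true (P : Prop) (x y : M) : P -> cond P x y = x.
Proof. unfold cond. destruct (excluded_middle_informative P); tauto. Qed.

Lemma cond_false (P : Prop) (x y : M) : ~ P -> cond P x y = y.
Proof. unfold cond. destruct (excluded_middle_informative P); tauto. Qed.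

Lemma Tm_cond (P : (nat -> M) -> Prop) (t u : (nat -> M) -> M) :
  Dfn P -> Tm t -> Tm u -> Tm (fun rho => cond (P rho) (t rho) (u rho)).
Proof.
  intros HP Ht Hu.
  apply (Dfn_iff _ (fun rho =>
    (P (fun k => rho (S k)) /\ rho 0 = t (fun k => rho (S k))) \/
    (~ P (fun k => rho (S k)) /\ rho 0 = u (fun k => rho (S k))))).
  - intros rho. destruct (classic (P (fun k => rho (S k)))).
    + rewrite cond_true by assumption. tauto.
    + rewrite cond_false by assumption. tauto.
  - pose proof (Dfn_subst _ (fun k => inl (S k)) HP) as HP'.
    apply Dfn_or; apply Dfn_and; try assumption. apply Dfn_not, HP'.
Qed.

End Definability.

(** Redefined after each batch of definability lemmas, so that [dfn] grows with the vocabulary. *)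
Ltac dfn_hook := fail.

Ltac dfn :=
  cbv beta;
  lazymatch goal with
  | |- DF ?F => try unfold F; unfold DF; dfn
  | |- Tm (fun _ => ?c) => apply Tm_const
  | |- Dfn (fun _ => ?P) => apply Dfn_const
  | |- Dfn (fun rho => _ /\ _) => apply Dfn_and; dfn
  | |- Dfn (fun rho => _ \/ _) => apply Dfn_or; dfn
  | |- Dfn (fun rho => _ <-> _) => apply Dfn_equiv; dfn
  | |- Dfn (fun rho => ~ _) => apply Dfn_not; dfn
  | |- Dfn (fun rho => exists x, _) => apply Dfn_ex; dfn
  | |- Dfn (fun rho => forall x : carrier _, _) => apply Dfn_all; dfn
  | |- Dfn (fun rho => _ -> _) => apply Dfn_imp; dfn
  | |- Dfn (fun rho => _ = _) => apply Dfn_eq; dfn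
  | |- Dfn (fun rho => _ ∈ _) => apply Dfn_mem; dfn
  | |- Tm (fun rho => cond _ _ _) => apply Tm_cond; dfn
  | |- _ => first [ apply Tm_var | dfn_hook ]
  end.

Existing Class ZF.

(** * Sets and functions *)

Section Sets.
Context {M : structure} {hZF : ZF M}.

Lemma ext (x y : M) : (forall z, z ∈ x <-> z ∈ y) -> x = y.
Proof. apply zf_extensionality, hZF. Qed.

Lemma carrier_inhabited : inhabited M.
Proof. destruct (zf_infinity M hZF) as (w & _). constructor. exact w. Qed.

Lemma separation (P : M -> Prop) (a : M) :
  Dfn (fun rho => P (rho 0)) -> exists b, forall x, x ∈ b <-> x ∈ a /\ P x.
Proof.
  intros (p & v & H).
  destruct (zf_separation M hZF
    (rename (fun k => match v k with inl _ => 0 | inr _ => S k end) p)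
    (fun k => match v k with inl _ => a | inr c => c end) a) as [b Hb].
  (* [P] looks only at coordinate 0, so the constant environment at [x] may serve for all
     coordinates. *)
  exists b. intros x. rewrite Hb, (H (fun _ => x)).
  rewrite (sat_rename M p _ _ (fun k => lookup (fun _ => x) (v k))); [tauto|].
  intros k. destruct (v k) eqn:E; simpl; rewrite ?E; reflexivity.
Qed.

Lemma replacement (R : M -> M -> Prop) (a : M) :
  Dfn (fun rho => R (rho 1) (rho 0)) ->
  (forall x y y', x ∈ a -> R x y -> R x y' -> y = y') ->
  exists b, forall y, y ∈ b <-> exists x, x ∈ a /\ R x y.
Proof.
  intros (p & v & H) HR.
  set (q := rename (fun k => match v k with inl 0 => 0 | inl _ => 1 | inr _ => S (S k) end) p).
  set (rho := fun k => match v k with inl _ => a | inr c => c end).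
  assert (E : forall x y, sat (scons y (scons x rho)) q <-> R x y).
  { intros x y. change (R x y) with (R (scons y (fun _ => x) 1) (scons y (fun _ => x) 0)).
    rewrite H. apply sat_rename.
    intros k. unfold rho. destruct (v k) as [[|i]|c] eqn:Ev; simpl; rewrite ?Ev; reflexivity. }
  destruct (zf_replacement M hZF q rho a) as [b Hb].
  - intros x y y' Hx. rewrite !E. apply HR, Hx.
  - exists b. intros y. rewrite Hb. split; intros (x & Hx & A); exists x; split; auto; apply E, A.
Qed.

(** Junk unless the class is a set. *)
Definition set_of (P : M -> Prop) : M :=
  epsilon carrier_inhabited (fun b => forall x, x ∈ b <-> P x).

Lemma in_set_of (P : M -> Prop) :
  (exists b : M, forall x, x ∈ b <-> P x) -> forall x, x ∈ set_of P <-> P x.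
Proof. apply (epsilon_spec carrier_inhabited (fun b => forall x, x ∈ b <-> P x)). Qed.

(** By extensionality a definition of membership in the value is a definition of the value. This is
    how operations introduced through [set_of] become definable. *)
Lemma Tm_set (t : (nat -> M) -> M) (Q : M -> (nat -> M) -> Prop) :
  (forall rho z, z ∈ t rho <-> Q z rho) ->
  Dfn (fun rho => Q (rho 0) (fun k => rho (S k))) -> Tm t.
Proof.
  intros E H.
  apply (Dfn_iff _ (fun rho => forall z, z ∈ rho 0 <-> Q z (fun k => rho (S k)))).
  - intros rho. split.
    + intros -> z. apply E.
    + intros A. apply ext. intros z. rewrite A, E. reflexivity.
  - apply Dfn_all. apply Dfn_equiv; [apply Dfn_mem; apply Tm_var | apply Dfn_shift, H].
Qed.

Definition upair (x y : M) : M := set_of (fun z => z = x \/ z = y).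
Definition sing (x : M) : M := upair x x.
Definition bigcup (x : M) : M := set_of (fun z => exists y, z ∈ y /\ y ∈ x).
Definition cup (x y : M) : M := bigcup (upair x y).
Definition succ (x : M) : M := cup x (sing x).
Definition power (x : M) : M := set_of (fun z => Subset z x).
Definition sep (a : M) (P : M -> Prop) : M := set_of (fun z => z ∈ a /\ P z).
Definition empty : M := set_of (fun _ => False).
Definition image (a : M) (F : M -> M) : M := set_of (fun y => exists x, x ∈ a /\ y = F x).
Definition opair (x y : M) : M := upair (sing x) (upair x y).

Lemma in_upair (x y z : M) : z ∈ upair x y <-> z = x \/ z = y.
Proof. revert z. apply in_set_of. apply zf_pairing, hZF. Qed.

Lemma in_sing (x z : M) : z ∈ sing x <-> z = x.
Proof. unfold sing. rewrite in_upair. tauto. Qed.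

Lemma in_bigcup (x z : M) : z ∈ bigcup x <-> exists y, z ∈ y /\ y ∈ x.
Proof. revert z. apply in_set_of. apply zf_union, hZF. Qed.

Lemma in_cup (x y z : M) : z ∈ cup x y <-> z ∈ x \/ z ∈ y.
Proof.
  unfold cup. rewrite in_bigcup. split.
  - intros (u & Hz & Hu). apply in_upair in Hu. destruct Hu; subst; auto.
  - intros [H|H]; [exists x | exists y]; rewrite in_upair; auto.
Qed.

Lemma in_succ (x z : M) : z ∈ succ x <-> z ∈ x \/ z = x.
Proof. unfold succ. rewrite in_cup, in_sing. reflexivity. Qed.

Lemma in_power (x z : M) : z ∈ power x <-> Subset z x.
Proof. revert z. apply in_set_of. apply zf_powerset, hZF. Qed.

Lemma in_sep (a : M) (P : M -> Prop) :
  Dfn (fun rho => P (rho 0)) -> forall z, z ∈ sep a P <-> z ∈ a /\ P z.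
Proof. intros H. apply in_set_of. apply separation, H. Qed.

Lemma in_empty (z : M) : z ∈ empty <-> False.
Proof.
  revert z. apply in_set_of. destruct (zf_infinity M hZF) as (w & (e & He & _) & _).
  exists e. intros x. split; [apply He | tauto].
Qed.

Lemma in_image (a : M) (F : M -> M) :
  DF F -> forall y, y ∈ image a F <-> exists x, x ∈ a /\ y = F x.
Proof.
  intros H. apply in_set_of. apply replacement; [exact H | congruence].
Qed.

Lemma Tm_upair (t u : (nat -> M) -> M) : Tm t -> Tm u -> Tm (fun rho => upair (t rho) (u rho)).
Proof.
  apply Tm_fun2. apply (Tm_set _ (fun z rho => z = rho 0 \/ z = rho 1)).
  - intros. apply in_upair.
  - dfn.
Qed.

Lemma Tm_bigcup (t : (nat -> M) -> M) : Tm t -> Tm (fun rho => bigcup (t rho)).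
Proof.
  intros H. apply (Tm_fun1 bigcup); [|exact H].
  apply (Tm_set (fun rho => bigcup (rho 0)) (fun z rho => exists y, z ∈ y /\ y ∈ rho 0)).
  - intros. apply in_bigcup.
  - dfn.
Qed.

Lemma Tm_power (t : (nat -> M) -> M) : Tm t -> Tm (fun rho => power (t rho)).
Proof.
  intros H. apply (Tm_fun1 power); [|exact H].
  apply (Tm_set (fun rho => power (rho 0)) (fun z rho => forall y, y ∈ z -> y ∈ rho 0)).
  - intros. apply in_power.
  - dfn.
Qed.

Lemma Tm_sep (a : (nat -> M) -> M) (P : M -> (nat -> M) -> Prop) :
  Tm a -> Dfn (fun rho => P (rho 0) (fun k => rho (S k))) ->
  Tm (fun rho => sep (a rho) (fun x => P x rho)).
Proof.
  intros Ha HP. apply (Tm_set _ (fun z rho => z ∈ a rho /\ P z rho)).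
  - intros rho z. apply (in_sep (a rho) (fun x => P x rho)).
    (* Once the environment is fixed, its coordinates become parameters. *)
    exact (Dfn_subst _ (fun k => match k with O => inl 0 | S i => inr (rho i) end) HP).
  - apply Dfn_and; [|exact HP]. apply Dfn_mem; [apply Tm_var|].
    exact (Tm_rename a S Ha).
Qed.

Lemma Tm_image (a : (nat -> M) -> M) (F : M -> (nat -> M) -> M) :
  Tm a -> Tm (fun rho => F (rho 0) (fun k => rho (S k))) ->
  Tm (fun rho => image (a rho) (fun x => F x rho)).
Proof.
  intros Ha HF. apply (Tm_set _ (fun z rho => exists x, x ∈ a rho /\ z = F x rho)).
  - intros rho z. apply (in_image (a rho) (fun x => F x rho)).
    exact (Dfn_subst _
      (fun k => match k with O => inl 0 | 1 => inl 1 | S (S i) => inr (rho i) end) HF).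
  - apply (Dfn_ex (fun x rho => x ∈ a (fun k => rho (S k)) /\ rho 0 = F x (fun k => rho (S k)))).
    apply Dfn_and.
    + apply Dfn_mem; [apply Tm_var|]. exact (Tm_rename a (fun k => S (S k)) Ha).
    + apply Dfn_eq; [apply Tm_var|].
      exact (Tm_rename _ (fun k => match k with O => 0 | S i => S (S i) end) HF).
Qed.

End Sets.

Ltac dfn_fun :=
  match goal with
  | H : DF ?F |- Tm (fun rho => ?F _) => apply (Tm_fun1 F H); dfn
  | H : Dfn (fun rho => ?P (rho 0)) |- Dfn (fun rho => ?P _) => apply (Dfn_rel1 P H); dfn
  | H : Dfn (fun rho => ?R (rho 0) (rho 1)) |- Dfn (fun rho => ?R _ _) =>
      apply (Dfn_rel2 R H); dfn
  | |- Tm (fun rho => upair _ _) => apply Tm_upair; dfn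
  | |- Tm (fun rho => sing _) => apply Tm_upair; dfn
  | |- Tm (fun rho => opair _ _) => unfold opair; dfn
  | |- Tm (fun rho => bigcup _) => apply Tm_bigcup; dfn
  | |- Tm (fun rho => cup _ _) => unfold cup; dfn
  | |- Tm (fun rho => succ _) => unfold succ; dfn
  | |- Tm (fun rho => power _) => apply Tm_power; dfn
  | |- Tm (fun rho => sep _ _) => apply Tm_sep; dfn
  | |- Tm (fun rho => image _ _) => apply Tm_image; dfn
  end.

Ltac dfn_hook ::= dfn_fun.

(** * Ordered pairs and set functions in definable form *)

Section Relations.
Context {M : structure} {hZF : ZF M}.

Lemma IsUPair_iff (p x y : M) : IsUPair p x y <-> p = upair x y.
Proof.
  split.
  - intros H. apply ext. intros z. rewrite (H z), in_upair. reflexivity.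
  - intros -> z. apply in_upair.
Qed.

Lemma IsEmpty_iff (x : M) : IsEmpty x <-> x = empty.
Proof.
  split.
  - intros H. apply ext. intros z. rewrite in_empty. split; [apply H | tauto].
  - intros -> z. rewrite in_empty. tauto.
Qed.

Lemma IsSucc_iff (x s : M) : IsSucc x s <-> s = succ x.
Proof.
  split.
  - intros H. apply ext. intros z. rewrite (H z), in_succ. reflexivity.
  - intros -> z. apply in_succ.
Qed.

Lemma IsPair_iff (p x y : M) : IsPair p x y <-> p = opair x y.
Proof.
  assert (E : forall z, IsUPair z x x \/ IsUPair z x y <-> z ∈ opair x y).
  { intros z. unfold opair, sing. rewrite in_upair, !IsUPair_iff. reflexivity. }
  split.
  - intros H. apply ext. intros z. rewrite (H z). apply E.
  - intros -> z. rewrite E. reflexivity.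
Qed.

Lemma Maps_iff (f x y : M) : Maps f x y <-> opair x y ∈ f.
Proof.
  split.
  - intros (p & Hp & Hf). apply IsPair_iff in Hp. subst p. exact Hf.
  - intros H. exists (opair x y). rewrite IsPair_iff. auto.
Qed.

Lemma upair_inj (x y x' y' : M) :
  upair x y = upair x' y' -> x = x' /\ y = y' \/ x = y' /\ y = x'.
Proof.
  intros E.
  assert (E' : forall z, z = x \/ z = y <-> z = x' \/ z = y').
  { intros z. rewrite <- !in_upair, E. reflexivity. }
  pose proof (proj1 (E' x) (or_introl eq_refl)).
  pose proof (proj1 (E' y) (or_intror eq_refl)).
  pose proof (proj2 (E' x') (or_introl eq_refl)).
  pose proof (proj2 (E' y') (or_intror eq_refl)).
  intuition congruence.
Qed.

Lemma opair_inj (x y x' y' : M) : opair x y = opair x' y' -> x = x' /\ y = y'.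
Proof.
  intros E. apply upair_inj in E. unfold sing in E.
  destruct E as [[E1 E2]|[E1 E2]]; apply upair_inj in E1; apply upair_inj in E2;
    intuition congruence.
Qed.

Lemma Dfn_Maps : Dfn (fun rho : nat -> M => Maps (rho 0) (rho 1) (rho 2)).
Proof.
  apply (Dfn_iff _ (fun rho => opair (rho 1) (rho 2) ∈ rho 0)).
  - intros rho. apply Maps_iff.
  - dfn.
Qed.

Lemma IsFun_iff (f a b : M) : IsFun f a b <->
  (forall p, p ∈ f -> exists x y, x ∈ a /\ y ∈ b /\ p = opair x y) /\
  (forall x, x ∈ a -> exists y, opair x y ∈ f /\ forall y', opair x y' ∈ f -> y = y').
Proof.
  unfold IsFun. split; intros [H1 H2]; split.
  - intros p Hp. destruct (H1 p Hp) as (x & y & ? & ? & ?). exists x, y.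
    rewrite <- IsPair_iff. auto.
  - intros x Hx. destruct (H2 x Hx) as (y & A & B). exists y.
    rewrite <- Maps_iff. split; [exact A|]. intros y'. rewrite <- Maps_iff. apply B.
  - intros p Hp. destruct (H1 p Hp) as (x & y & ? & ? & ?). exists x, y.
    rewrite IsPair_iff. auto.
  - intros x Hx. destruct (H2 x Hx) as (y & A & B). exists y.
    split; [apply Maps_iff, A|]. intros y'. rewrite Maps_iff. apply B.
Qed.

Lemma Dfn_IsFun : Dfn (fun rho : nat -> M => IsFun (rho 0) (rho 1) (rho 2)).
Proof. eapply Dfn_iff; [intros rho; apply IsFun_iff | dfn]. Qed.

End Relations.

Ltac dfn_rel :=
  lazymatch goal with
  | |- Dfn (fun rho => Subset _ _) => unfold Subset; dfn
  | |- Dfn (fun rho => Maps _ _ _) => apply (Dfn_rel3 Maps Dfn_Maps); dfn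
  | |- Dfn (fun rho => IsFun _ _ _) => apply (Dfn_rel3 IsFun Dfn_IsFun); dfn
  end.

Ltac dfn_hook ::= first [dfn_fun | dfn_rel].

Section MoreRelations.
Context {M : structure} {hZF : ZF M}.

Lemma Dfn_CardEq : Dfn (fun rho : nat -> M => CardEq (rho 0) (rho 1)).
Proof. unfold CardEq, IsBij, IsInj. dfn. Qed.

Lemma Dfn_CardLe : Dfn (fun rho : nat -> M => CardLe (rho 0) (rho 1)).
Proof. unfold CardLe, IsInj. dfn. Qed.

Lemma Dfn_Ordinal : Dfn (fun rho : nat -> M => Ordinal (rho 0)).
Proof. unfold Ordinal, Transitive, WellOrderedByMem. dfn. Qed.

End MoreRelations.

Ltac dfn_rel2 :=
  lazymatch goal with
  | |- Dfn (fun rho => CardEq _ _) => apply (Dfn_rel2 CardEq Dfn_CardEq); dfn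
  | |- Dfn (fun rho => CardLe _ _) => apply (Dfn_rel2 CardLe Dfn_CardLe); dfn
  | |- Dfn (fun rho => Ordinal _) => apply (Dfn_rel1 Ordinal Dfn_Ordinal); dfn
  end.

Ltac dfn_hook ::= first [dfn_fun | dfn_rel | dfn_rel2].

(** * Set functions as restrictions of definable class functions *)

Section Functions.
Context {M : structure} {hZF : ZF M}.

(** The value of the set function [f] at [x], as the union of all values, so
    that it is [empty] outside the domain. *)
Definition app (f x : M) : M := set_of (fun z => exists y, Maps f x y /\ z ∈ y).

Definition lam (a : M) (F : M -> M) : M := image a (fun x => opair x (F x)).

Lemma in_app (f x z : M) : z ∈ app f x <-> exists y, Maps f x y /\ z ∈ y.
Proof.
  revert z. apply in_set_of.
  exists (sep (bigcup (bigcup (bigcup f))) (fun z => exists y, Maps f x y /\ z ∈ y)).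
  intros z. rewrite in_sep by dfn. split; [tauto|]. intros (y & Hf & Hz).
  split; [|exists y; auto]. apply Maps_iff in Hf.
  apply in_bigcup. exists y. split; [exact Hz|].
  apply in_bigcup. exists (upair x y). split; [apply in_upair; auto|].
  apply in_bigcup. exists (opair x y). split; [apply in_upair; auto | exact Hf].
Qed.

Lemma Tm_app (t u : (nat -> M) -> M) : Tm t -> Tm u -> Tm (fun rho => app (t rho) (u rho)).
Proof.
  apply Tm_fun2. apply (Tm_set _ (fun z rho => exists y, Maps (rho 0) (rho 1) y /\ z ∈ y)).
  - intros. apply in_app.
  - dfn.
Qed.

Lemma app_eq (f a b x y : M) : IsFun f a b -> Maps f x y -> x ∈ a /\ y ∈ b /\ y = app f x.
Proof.
  intros [H1 H2]%IsFun_iff H.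
  assert (H' := H). apply Maps_iff in H'.
  destruct (H1 _ H') as (x' & y' & Hx & Hy & E).
  apply opair_inj in E. destruct E as [<- <-].
  split; [exact Hx|]. split; [exact Hy|].
  apply ext. intros z. rewrite in_app. split.
  - intros Hz. exists y. auto.
  - intros (y' & Hy' & Hz). apply Maps_iff in Hy'.
    destruct (H2 x Hx) as (y0 & _ & U). rewrite <- (U _ H'), (U _ Hy'). exact Hz.
Qed.

Lemma app_spec (f a b x : M) : IsFun f a b -> x ∈ a -> Maps f x (app f x) /\ app f x ∈ b.
Proof.
  intros Hf Hx. destruct (proj2 Hf x Hx) as (y & Hy & _).
  destruct (app_eq _ _ _ _ _ Hf Hy) as (_ & Hb & <-). auto.
Qed.

Lemma Maps_lam (a : M) (F : M -> M) : DF F ->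
  forall x y, Maps (lam a F) x y <-> x ∈ a /\ y = F x.
Proof.
  intros HF x y. rewrite Maps_iff. unfold lam. rewrite in_image by dfn. split.
  - intros (z & Hz & [-> ->]%opair_inj). auto.
  - intros [Hx ->]. exists x. auto.
Qed.

Lemma IsFun_lam (a b : M) (F : M -> M) :
  DF F -> (forall x, x ∈ a -> F x ∈ b) -> IsFun (lam a F) a b.
Proof.
  intros HF H. split.
  - intros p. unfold lam. rewrite in_image by dfn. intros (x & Hx & ->).
    exists x, (F x). rewrite IsPair_iff. auto.
  - intros x Hx. exists (F x). split; [apply Maps_lam; auto|].
    intros y. rewrite Maps_lam by exact HF. intros [_ E]; auto.
Qed.

Lemma app_lam (a : M) (F : M -> M) (x : M) : DF F -> x ∈ a -> app (lam a F) x = F x.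
Proof.
  intros HF Hx. apply ext. intros z. rewrite in_app. split.
  - intros (y & Hy & Hz). apply Maps_lam in Hy; [|exact HF]. destruct Hy as [_ ->]. exact Hz.
  - intros Hz. exists (F x). rewrite Maps_lam by exact HF. auto.
Qed.

Definition maps_to (F : M -> M) (a b : M) : Prop := forall x, x ∈ a -> F x ∈ b.

Definition inj_on (F : M -> M) (a : M) : Prop :=
  forall x x', x ∈ a -> x' ∈ a -> F x = F x' -> x = x'.

Definition onto (F : M -> M) (a b : M) : Prop :=
  forall y, y ∈ b -> exists x, x ∈ a /\ y = F x.

Lemma DF_app (f : M) : DF (app f).
Proof. exact (Tm_app (fun _ => f) (fun rho => rho 0) (Tm_const f) (Tm_var 0)). Qed.

Lemma IsInj_app (f a b : M) : IsInj f a b -> maps_to (app f) a b /\ inj_on (app f) a.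
Proof.
  intros [Hf Hi]. split.
  - intros x Hx. apply (app_spec _ _ _ _ Hf Hx).
  - intros x x' Hx Hx' E. apply (Hi x x' (app f x)).
    + apply (app_spec _ _ _ _ Hf Hx).
    + rewrite E. apply (app_spec _ _ _ _ Hf Hx').
Qed.

Lemma IsBij_app (f a b : M) :
  IsBij f a b -> maps_to (app f) a b /\ inj_on (app f) a /\ onto (app f) a b.
Proof.
  intros [Hi Hs]. destruct (IsInj_app _ _ _ Hi) as [H1 H2].
  split; [exact H1|]. split; [exact H2|].
  intros y Hy. destruct (Hs y Hy) as [x Hx]. exists x.
  destruct (app_eq _ _ _ _ _ (proj1 Hi) Hx) as (? & _ & ?). auto.
Qed.

Lemma IsInj_lam (a b : M) (F : M -> M) :
  DF F -> maps_to F a b -> inj_on F a -> IsInj (lam a F) a b.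
Proof.
  intros HF H1 H2. split; [apply IsFun_lam; assumption|].
  intros x x' y. rewrite !Maps_lam by exact HF. intros [Hx ->] [Hx' E]. auto.
Qed.

Lemma IsBij_lam (a b : M) (F : M -> M) :
  DF F -> maps_to F a b -> inj_on F a -> onto F a b -> IsBij (lam a F) a b.
Proof.
  intros HF H1 H2 H3. split; [apply IsInj_lam; assumption|].
  intros y Hy. destruct (H3 y Hy) as (x & Hx & E). exists x. apply Maps_lam; auto.
Qed.

Lemma CardLe_elim (a b : M) :
  CardLe a b -> exists F, DF F /\ maps_to F a b /\ inj_on F a.
Proof. intros (f & Hf). exists (app f). split; [apply DF_app | apply IsInj_app, Hf]. Qed.

Lemma CardLe_intro (a b : M) (F : M -> M) :
  DF F -> maps_to F a b -> inj_on F a -> CardLe a b.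
Proof. intros. exists (lam a F). apply IsInj_lam; assumption. Qed.

Lemma CardEq_elim (a b : M) :
  CardEq a b -> exists F, DF F /\ maps_to F a b /\ inj_on F a /\ onto F a b.
Proof. intros (f & Hf). exists (app f). split; [apply DF_app | apply IsBij_app, Hf]. Qed.

Lemma CardEq_intro (a b : M) (F : M -> M) :
  DF F -> maps_to F a b -> inj_on F a -> onto F a b -> CardEq a b.
Proof. intros. exists (lam a F). apply IsBij_lam; assumption. Qed.

(** Over a value of [F], injective on [a], the fibre is a singleton, and the union of a singleton is
    its element. *)
Definition inverse (F : M -> M) (a y : M) : M := bigcup (sep a (fun x => F x = y)).

Lemma DF_inverse (F : M -> M) (a : M) : DF F -> DF (inverse F a).
Proof. intros HF. unfold inverse. dfn. Qed.

Lemma inverse_eq (F : M -> M) (a x : M) :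
  DF F -> inj_on F a -> x ∈ a -> inverse F a (F x) = x.
Proof.
  intros HF Hi Hx. apply ext. intros z. unfold inverse. rewrite in_bigcup. split.
  - intros (y & Hz & Hy). apply in_sep in Hy; [|dfn]. destruct Hy as [Hy E].
    rewrite <- (Hi y x Hy Hx E). exact Hz.
  - intros Hz. exists x. rewrite in_sep by dfn. auto.
Qed.

Lemma CardEq_refl (a : M) : CardEq a a.
Proof.
  apply (CardEq_intro _ _ (fun x => x)); [dfn | | |]; intros x; intros; [assumption..|].
  exists x. auto.
Qed.

Lemma CardEq_sym (a b : M) : CardEq a b -> CardEq b a.
Proof.
  intros (F & HF & Hm & Hi & Ho)%CardEq_elim.
  apply (CardEq_intro _ _ (inverse F a)).
  - apply DF_inverse, HF.
  - intros y Hy. destruct (Ho y Hy) as (x & Hx & ->). rewrite inverse_eq; auto.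
  - intros y y' Hy Hy'. destruct (Ho y Hy) as (x & Hx & ->), (Ho y' Hy') as (x' & Hx' & ->).
    rewrite !inverse_eq by auto. congruence.
  - intros x Hx. exists (F x). rewrite inverse_eq; auto.
Qed.

Lemma CardEq_trans (a b c : M) : CardEq a b -> CardEq b c -> CardEq a c.
Proof.
  intros (F & HF & Hm & Hi & Ho)%CardEq_elim (G & HG & Gm & Gi & Go)%CardEq_elim.
  apply (CardEq_intro _ _ (fun x => G (F x))).
  - dfn.
  - intros x Hx. auto.
  - intros x x' Hx Hx' E. auto.
  - intros z Hz. destruct (Go z Hz) as (y & Hy & ->), (Ho y Hy) as (x & Hx & ->).
    exists x. auto.
Qed.

Lemma CardLe_trans (a b c : M) : CardLe a b -> CardLe b c -> CardLe a c.
Proof.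
  intros (F & HF & Hm & Hi)%CardLe_elim (G & HG & Gm & Gi)%CardLe_elim.
  apply (CardLe_intro _ _ (fun x => G (F x))).
  - dfn.
  - intros x Hx. auto.
  - intros x x' Hx Hx' E. auto.
Qed.

Lemma CardEq_CardLe (a b : M) : CardEq a b -> CardLe a b.
Proof. intros (f & Hf & _). exists f. exact Hf. Qed.

Lemma CardLe_Subset (a b : M) : Subset a b -> CardLe a b.
Proof.
  intros H. apply (CardLe_intro _ _ (fun x => x)).
  - dfn.
  - exact H.
  - intros x x' _ _ E. exact E.
Qed.

End Functions.

Ltac dfn_app :=
  lazymatch goal with
  | |- Tm (fun rho => app _ _) => apply Tm_app; dfn
  end.

Ltac dfn_hook ::= first [dfn_fun | dfn_rel | dfn_rel2 | dfn_app].

(** * Ordinals *)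

Section Ordinals.
Context {M : structure} {hZF : ZF M}.

Lemma ord_trans (x y z : M) : Ordinal x -> y ∈ x -> z ∈ y -> z ∈ x.
Proof. intros [Ht _] Hy. apply Ht, Hy. Qed.

Lemma ord_irrefl (x : M) : Ordinal x -> x ∉ x.
Proof. intros [_ (H & _)] Hx. exact (H x Hx Hx). Qed.

Lemma ord_mem (x y : M) : Ordinal x -> y ∈ x -> Ordinal y.
Proof.
  intros Hx Hy. assert (Hs : Subset y x) by (apply Hx, Hy).
  destruct Hx as [Ht (H1 & H2 & H3 & H4)]. split.
  - intros z Hz u Hu.
    apply (H2 u z y); auto. apply (Ht z); auto.
  - repeat split; auto.
    + intros a b c Ha Hb Hc. apply H2; auto.
    + intros s Hsy. apply H4. intros z Hz. auto.
Qed.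

Lemma ord_min_in (a : M) (P : M -> Prop) :
  Dfn (fun rho => P (rho 0)) -> Ordinal a -> (exists x, x ∈ a /\ P x) ->
  exists m, m ∈ a /\ P m /\ forall x, x ∈ m -> ~ P x.
Proof.
  intros HP Ha (x & Hx & Px).
  destruct Ha as [Ht (H1 & H2 & H3 & H4)].
  destruct (H4 (sep a P)) as (m & Hm & Hmin).
  - intros z. rewrite in_sep by exact HP. tauto.
  - exists x. rewrite in_sep by exact HP. auto.
  - apply in_sep in Hm; [|exact HP]. destruct Hm as [Hm Pm].
    exists m. split; [exact Hm|]. split; [exact Pm|].
    intros z Hz Pz. assert (Hza : z ∈ a) by exact (Ht m Hm z Hz).
    destruct (Hmin z) as [<-|Hmz].
    + apply in_sep; auto.
    + exact (H1 m Hm Hz).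
    + apply (H1 m Hm). apply (H2 m z m); auto.
Qed.

Lemma ord_ind (P : M -> Prop) : Dfn (fun rho => P (rho 0)) ->
  (forall x, Ordinal x -> (forall y, y ∈ x -> P y) -> P x) -> forall x, Ordinal x -> P x.
Proof.
  intros HP H x Hx. apply H; [exact Hx|]. intros y Hy. apply NNPP. intros Py.
  destruct (ord_min_in x (fun z => ~ P z)) as (m & Hm & Pm & Hmin).
  - dfn.
  - exact Hx.
  - exists y. auto.
  - apply Pm, H; [exact (ord_mem x m Hx Hm)|].
    intros z Hz. apply NNPP, Hmin, Hz.
Qed.

Lemma ord_min (P : M -> Prop) (a : M) :
  Dfn (fun rho => P (rho 0)) -> Ordinal a -> P a ->
  exists m, Ordinal m /\ P m /\ (m ∈ a \/ m = a) /\ forall x, x ∈ m -> ~ P x.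
Proof.
  intros HP Ha Pa.
  destruct (classic (exists x, x ∈ a /\ P x)) as [H|H].
  - destruct (ord_min_in a P HP Ha H) as (m & Hm & Pm & Hmin).
    exists m. split; [exact (ord_mem a m Ha Hm) | auto].
  - exists a. repeat (split; [auto; fail|]). intros x Hx Px. apply H. exists x. auto.
Qed.

(** Double induction: if neither of [x] and [y] belongs to the other, the induction hypotheses put
    every member of each into the other, and extensionality makes them equal. *)
Lemma ord_trichotomy (x y : M) : Ordinal x -> Ordinal y -> x ∈ y \/ x = y \/ y ∈ x.
Proof.
  intros Hx. revert y.
  refine (ord_ind (fun x => forall y, Ordinal y -> x ∈ y \/ x = y \/ y ∈ x) _ _ x Hx); [dfn|].
  clear x Hx. intros x Hx IHx.
  apply (ord_ind (fun y => x ∈ y \/ x = y \/ y ∈ x)); [dfn|].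
  intros y Hy IHy. apply NNPP. intros H. apply H. right. left. apply ext. intros z. split.
  - intros Hz. destruct (IHx z Hz y Hy) as [A|[->|A]]; [exact A| |]; exfalso; apply H; auto.
    right; right. exact (ord_trans x z y Hx Hz A).
  - intros Hz. destruct (IHy z Hz) as [A|[->|A]]; [| |exact A]; exfalso; apply H; auto.
    left. exact (ord_trans y z x Hy Hz A).
Qed.

Lemma ord_subset (x y : M) : Ordinal x -> Ordinal y -> Subset x y -> x ∈ y \/ x = y.
Proof.
  intros Hx Hy H. destruct (ord_trichotomy x y Hx Hy) as [A|[A|A]]; auto.
  destruct (ord_irrefl y Hy). apply H, A.
Qed.

Lemma ord_not_mem (x y : M) : Ordinal x -> Ordinal y -> x ∉ y -> Subset y x.
Proof.
  intros Hx Hy H z Hz. destruct (ord_trichotomy x y Hx Hy) as [A|[->|A]].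
  - contradiction.
  - exact Hz.
  - exact (ord_trans x y z Hx A Hz).
Qed.

Lemma ord_of_transitive (x : M) : Transitive x -> (forall y, y ∈ x -> Ordinal y) -> Ordinal x.
Proof.
  intros Ht Ho. split; [exact Ht|]. split; [|split; [|split]].
  - intros a Ha. apply ord_irrefl, Ho, Ha.
  - intros a b c _ _ Hc Hab Hbc. exact (ord_trans c b a (Ho c Hc) Hbc Hab).
  - intros a b Ha Hb. apply ord_trichotomy; auto.
  - intros s Hs [a Ha].
    destruct (ord_min (fun z => z ∈ s) a) as (m & Hm & Pm & _ & Hmin);
      [dfn | auto | exact Ha |].
    exists m. split; [exact Pm|]. intros b Hb.
    destruct (ord_trichotomy m b Hm) as [A|[A|A]]; auto.
    destruct (Hmin b A Hb).
Qed.

Lemma ord_empty : Ordinal (@empty M hZF).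
Proof. apply ord_of_transitive; intros y []%in_empty. Qed.

Lemma ord_succ (x : M) : Ordinal x -> Ordinal (succ x).
Proof.
  intros Hx. apply ord_of_transitive.
  - intros y Hy z Hz. rewrite in_succ in *. destruct Hy as [Hy| ->]; [|auto].
    left. exact (ord_trans x y z Hx Hy Hz).
  - intros y [Hy| ->]%in_succ; [exact (ord_mem x y Hx Hy) | exact Hx].
Qed.

Lemma ord_bigcup (a : M) : (forall x, x ∈ a -> Ordinal x) -> Ordinal (bigcup a).
Proof.
  intros H. apply ord_of_transitive.
  - intros y Hy z Hz. rewrite in_bigcup in *. destruct Hy as (x & Hy & Hx).
    exists x. split; [|exact Hx]. exact (ord_trans x y z (H x Hx) Hy Hz).
  - intros y (x & Hy & Hx)%in_bigcup. exact (ord_mem x y (H x Hx) Hy).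
Qed.

Lemma ord_succ_subset (x y : M) : Ordinal x -> y ∈ x -> Subset (succ y) x.
Proof. intros Hx Hy z [Hz| ->]%in_succ; [exact (ord_trans x y z Hx Hy Hz) | exact Hy]. Qed.

Lemma empty_neq_succ (x : M) : empty <> succ x.
Proof. intros H. apply (in_empty x). rewrite H. apply in_succ. auto. Qed.

Lemma succ_inj (x y : M) : Ordinal x -> Ordinal y -> succ x = succ y -> x = y.
Proof.
  intros Hx Hy E.
  assert (H1 : x ∈ succ y) by (rewrite <- E; apply in_succ; auto).
  assert (H2 : y ∈ succ x) by (rewrite E; apply in_succ; auto).
  rewrite in_succ in *. destruct H1 as [H1|H1]; [|exact H1].
  destruct H2 as [H2|H2]; [|auto].
  destruct (ord_irrefl x Hx). exact (ord_trans x y x Hx H2 H1).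
Qed.

(** At a least [m] with [F m ∈ m], monotonicity would make [F m] a smaller such point. *)
Lemma strictly_increasing_expansive (F : M -> M) (t : M) :
  DF F -> Ordinal t -> (forall a, a ∈ t -> Ordinal (F a)) ->
  (forall a b, a ∈ b -> b ∈ t -> F a ∈ F b) -> forall a, a ∈ t -> F a ∉ a.
Proof.
  intros HF Ht Ho Hm a Ha Hfa.
  destruct (ord_min_in t (fun x => F x ∈ x)) as (m & Hmt & Hfm & Hmin).
  - dfn.
  - exact Ht.
  - exists a. auto.
  - apply (Hmin (F m) Hfm). apply Hm; assumption.
Qed.

(** The value is collected from its members, so a definable total function results without selecting
    anything; off the domain of [R] it is [empty]. *)
Lemma DF_of_graph (R : M -> M -> Prop) :
  Dfn (fun rho => R (rho 0) (rho 1)) -> (forall x y y', R x y -> R x y' -> y = y') ->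
  exists F : M -> M, DF F /\ forall x y, R x y -> F x = y.
Proof.
  intros HR Hu.
  exists (fun x => set_of (fun z => exists y, R x y /\ z ∈ y)).
  assert (E : forall x z, z ∈ set_of (fun z => exists y, R x y /\ z ∈ y)
    <-> exists y, R x y /\ z ∈ y).
  { intros x. apply in_set_of. destruct (classic (exists y, R x y)) as [[y Hy]|H].
    - exists y. intros z. split; [eauto|]. intros (y' & Hy' & Hz).
      rewrite (Hu x y y' Hy Hy'). exact Hz.
    - exists empty. intros z. rewrite in_empty. firstorder. }
  split.
  - apply (Tm_set (fun rho => set_of (fun z => exists y, R (rho 0) y /\ z ∈ y))
      (fun z rho => exists y, R (rho 0) y /\ z ∈ y)).
    + intros. apply E.
    + dfn.
  - intros x y H. apply ext. intros z. rewrite E. split; [|eauto].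
    intros (y' & Hy' & Hz). rewrite (Hu x y y' H Hy'). exact Hz.
Qed.

(** * Transfinite recursion *)

Section Recursion.
Context (S : M) (Phi : M -> M) (HPhi : DF Phi).

Let values (h x : M) : M :=
  sep (bigcup (bigcup h)) (fun w => exists z, z ∈ x /\ z ∈ S /\ Maps h z w).

Let approximation (h : M) : Prop :=
  forall x y, Maps h x y ->
    Ordinal x /\ (forall z, z ∈ x -> exists w, Maps h z w) /\ y = Phi (values h x).

Let graph (x y : M) : Prop := exists h, approximation h /\ Maps h x y.

Let in_values (h x w : M) : w ∈ values h x <-> exists z, z ∈ x /\ z ∈ S /\ Maps h z w.
Proof.
  unfold values. rewrite in_sep by dfn. split; [tauto|]. intros H.
  split; [|exact H]. destruct H as (z & _ & _ & H). apply Maps_iff in H.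
  apply in_bigcup. exists (upair z w). split; [apply in_upair; auto|].
  apply in_bigcup. exists (opair z w). split; [apply in_upair; auto | exact H].
Qed.

Let graph_unique (x y y' : M) : graph x y -> graph x y' -> y = y'.
Proof.
  intros Hy. assert (Hx : Ordinal x) by (destruct Hy as (h & Hh & H); apply (Hh x y H)).
  revert y y' Hy.
  refine (ord_ind (fun x => forall y y', graph x y -> graph x y' -> y = y') _ _ x Hx).
  { unfold graph, approximation, values. dfn. }
  clear x Hx. intros x Hx IH y y' (h & Hh & H) (h' & Hh' & H').
  destruct (Hh x y H) as (_ & D & ->), (Hh' x y' H') as (_ & D' & ->).
  f_equal. apply ext. intros w. rewrite !in_values.
  split; intros (z & Hz & HzS & Hw); exists z; split; auto; split; auto.
  - destruct (D' z Hz) as [w' Hw'].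
    rewrite (IH z Hz w w'); [exact Hw' | exists h; auto | exists h'; auto].
  - destruct (D z Hz) as [w' Hw'].
    rewrite (IH z Hz w w'); [exact Hw' | exists h'; auto | exists h; auto].
Qed.

(** Collecting only the values at indices in [S] covers two uses: recursion along ω, and the
    collapse of an arbitrary set of ordinals. [F] is the union of all approximations, which agree by
    [graph_unique]. *)
Lemma recursion : exists F : M -> M,
  DF F /\ forall x, Ordinal x -> F x = Phi (image (sep x (fun z => z ∈ S)) F).
Proof.
  destruct (DF_of_graph graph) as (F & HF & EF).
  { unfold graph, approximation, values. dfn. }
  { exact graph_unique. }
  exists F. split; [exact HF|].
  assert (E : forall h x, approximation h -> (forall z, z ∈ x -> exists w, Maps h z w) ->
    values h x = image (sep x (fun z => z ∈ S)) F).
  { intros h x Hh D. apply ext. intros w. rewrite in_values, in_image by exact HF.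
    split; intros (z & H).
    - exists z. rewrite in_sep by dfn. destruct H as (Hz & HS & Hw).
      split; [auto|]. symmetry. apply EF. exists h. auto.
    - rewrite in_sep in H by dfn. destruct H as ([Hz HS] & ->).
      exists z. split; [auto|]. split; [auto|].
      destruct (D z Hz) as [w Hw]. rewrite (EF z w); [exact Hw | exists h; auto]. }
  assert (T : forall x, Ordinal x -> exists y, graph x y).
  { apply (ord_ind (fun x => exists y, graph x y)).
    { unfold graph, approximation, values. dfn. }
    intros x Hx IH. set (y := Phi (image (sep x (fun z => z ∈ S)) F)).
    exists y.
    (* The equation for [F] is not yet known at [x]. The approximation on [succ x] therefore follows
       [F] below [x] and takes the prescribed value at [x]. *)
    set (G := fun z => cond (z = x) y (F z)).
    assert (HG : DF G) by dfn.
    assert (G1 : G x = y) by (apply cond_true; reflexivity).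
    assert (G2 : forall z, z ∈ x -> G z = F z).
    { intros z Hz. apply cond_false. intros ->. exact (ord_irrefl x Hx Hz). }
    assert (V : forall z, Subset z x ->
      values (lam (succ x) G) z = image (sep z (fun u => u ∈ S)) F).
    { intros z Hz. apply ext. intros w. rewrite in_values, in_image by exact HF.
      split; intros (u & H); exists u.
      - destruct H as (Hu & HS & Hw). apply Maps_lam in Hw; [|exact HG].
        rewrite in_sep by dfn. rewrite <- (G2 u) by auto. tauto.
      - rewrite in_sep in H by dfn. rewrite Maps_lam by exact HG.
        rewrite in_succ, (G2 u) by (apply Hz; tauto). intuition. }
    exists (lam (succ x) G). split.
    - intros z w Hw. apply Maps_lam in Hw; [|exact HG]. destruct Hw as [Hz ->].
      assert (Hzx : Subset z x).
      { apply in_succ in Hz. destruct Hz as [Hz| ->]; [|intros u; auto].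
        intros u. exact (ord_trans x z u Hx Hz). }
      split; [|split].
      + apply in_succ in Hz. destruct Hz as [Hz| ->]; [exact (ord_mem x z Hx Hz) | exact Hx].
      + intros u Hu. exists (G u). apply Maps_lam; [exact HG|]. rewrite in_succ. auto.
      + rewrite (V z Hzx). apply in_succ in Hz. destruct Hz as [Hz| ->]; [|exact G1].
        rewrite (G2 z Hz). destruct (IH z Hz) as [w Hw]. rewrite (EF z w Hw).
        destruct Hw as (h & Hh & Hw). destruct (Hh z w Hw) as (_ & D & ->).
        rewrite (E h z Hh D). reflexivity.
    - apply Maps_lam; [exact HG|]. rewrite in_succ. auto. }
  intros x Hx. destruct (T x Hx) as [y Hy]. rewrite (EF x y Hy).
  destruct Hy as (h & Hh & Hy). destruct (Hh x y Hy) as (_ & D & ->).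
  rewrite (E h x Hh D). reflexivity.
Qed.

End Recursion.

End Ordinals.

(** * Order types *)

Section OrderTypes.
Context {M : structure} {hZF : ZF M}.

Definition increasing_on (F : M -> M) (t : M) : Prop :=
  forall a b, a ∈ t -> b ∈ t -> a ∈ b -> F a ∈ F b.

Lemma increasing_reflects (F : M -> M) (h : M) :
  (forall x, x ∈ h -> Ordinal x) -> (forall x, x ∈ h -> Ordinal (F x)) ->
  increasing_on F h -> forall a b, a ∈ h -> b ∈ h -> F a ∈ F b -> a ∈ b.
Proof.
  intros Ho HoF Hm a b Ha Hb H.
  destruct (ord_trichotomy a b (Ho a Ha) (Ho b Hb)) as [A|[->|A]]; [exact A| |].
  - destruct (ord_irrefl (F b) (HoF b Hb) H).
  - destruct (ord_irrefl (F a) (HoF a Ha)).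
    apply (ord_trans (F a) (F b)); auto.
Qed.

Lemma increasing_inj (F : M -> M) (h : M) :
  (forall x, x ∈ h -> Ordinal x) -> (forall x, x ∈ h -> Ordinal (F x)) ->
  increasing_on F h -> inj_on F h.
Proof.
  intros Ho HoF Hm a b Ha Hb H.
  destruct (ord_trichotomy a b (Ho a Ha) (Ho b Hb)) as [A|[A|A]]; [|exact A|];
    apply Hm in A; auto; rewrite H in A; destruct (ord_irrefl (F b)); auto.
Qed.

Lemma HasOrderType_intro (h t : M) (G : M -> M) :
  DF G -> Ordinal t -> (forall x, x ∈ h -> Ordinal x) ->
  maps_to G t h -> onto G t h -> increasing_on G t -> HasOrderType h t.
Proof.
  intros HG Ht Hh Gm Go Gi.
  assert (Hto : forall a, a ∈ t -> Ordinal a) by (intros a; apply ord_mem, Ht).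
  split; [exact Ht|]. exists (lam t G). split.
  - apply IsBij_lam; auto. apply increasing_inj; auto.
  - intros a b x y. rewrite !Maps_lam by exact HG. intros [Ha ->] [Hb ->].
    split; [apply Gi; assumption|].
    apply (increasing_reflects G t); auto.
Qed.

Lemma HasOrderType_elim (h t : M) : HasOrderType h t ->
  Ordinal t /\ exists G, DF G /\ maps_to G t h /\ inj_on G t /\ onto G t h /\ increasing_on G t.
Proof.
  intros (Ht & g & Hg & Hm). split; [exact Ht|].
  exists (app g). split; [apply DF_app|].
  destruct (IsBij_app _ _ _ Hg) as (G1 & G2 & G3).
  split; [exact G1|]. split; [exact G2|]. split; [exact G3|].
  intros a b Ha Hb. apply (Hm a b); apply (app_spec g t h); auto; apply Hg.
Qed.

Lemma HasOrderType_CardEq (h t : M) : HasOrderType h t -> CardEq t h.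
Proof. intros (_ & g & Hg & _). exists g. exact Hg. Qed.

(** The increasing enumeration [G] of [h] satisfies [a ≤ G a], and [G a] lies in [x]; hence every
    [a] below [t] is in [x]. *)
Lemma order_type_bound (h t x : M) :
  HasOrderType h t -> Ordinal x -> Subset h x -> t ∈ x \/ t = x.
Proof.
  intros (Ht & G & HG & Gm & _ & _ & Gi)%HasOrderType_elim Hx Hh.
  apply ord_subset; auto. intros a Ha.
  assert (HGa : G a ∈ x) by (apply Hh, Gm, Ha).
  assert (HaG : G a ∉ a).
  { apply (strictly_increasing_expansive G t); auto.
    - intros b Hb. apply (ord_mem x); auto.
    - intros b c Hb Hc. apply Gi; auto. apply (ord_trans t c); auto. }
  destruct (ord_trichotomy (G a) a) as [A|[A|A]].
  - apply (ord_mem x); auto.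
  - apply (ord_mem t); auto.
  - contradiction.
  - rewrite <- A. exact HGa.
  - exact (ord_trans x (G a) a Hx HGa A).
Qed.

(** The order type is the range of the collapsing map [F x = {F y | y ∈ x ∩ S}]. *)
Lemma order_type_exists (S : M) :
  (forall x, x ∈ S -> Ordinal x) -> exists t, HasOrderType S t.
Proof.
  intros HS.
  destruct (recursion S (fun x => x)) as (F & HF & EF); [dfn|].
  assert (EF' : forall x u, Ordinal x -> (u ∈ F x <-> exists y, y ∈ x /\ y ∈ S /\ u = F y)).
  { intros x u Hx. rewrite (EF x Hx), in_image by exact HF.
    split; intros (y & Hy); exists y; rewrite in_sep in * by dfn; tauto. }
  assert (HoF : forall x, Ordinal x -> Ordinal (F x)).
  { apply (ord_ind (fun x => Ordinal (F x))); [dfn|].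
    intros x Hx IH. apply ord_of_transitive.
    - intros u Hu v Hv. apply EF' in Hu; [|exact Hx]. destruct Hu as (y & Hy & HyS & ->).
      apply EF' in Hv; [|apply HS, HyS]. destruct Hv as (z & Hz & HzS & ->).
      apply EF'; [exact Hx|]. exists z. split; [|auto]. exact (ord_trans x y z Hx Hy Hz).
    - intros u Hu. apply EF' in Hu; [|exact Hx]. destruct Hu as (y & Hy & _ & ->). auto. }
  assert (HFS : forall x, x ∈ S -> Ordinal (F x)) by auto.
  assert (Fi : increasing_on F S).
  { intros a b Ha Hb Hab. apply EF'; [auto|]. exists a. auto. }
  assert (Finj : inj_on F S) by (apply increasing_inj; auto).
  exists (image S F).
  apply (HasOrderType_intro _ _ (inverse F S)).
  - apply DF_inverse, HF.
  - apply ord_of_transitive.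
    + intros u Hu v Hv. rewrite in_image in * by exact HF. destruct Hu as (y & Hy & ->).
      apply EF' in Hv; [|auto]. destruct Hv as (z & Hz & HzS & ->). exists z. auto.
    + intros u Hu. apply in_image in Hu; [|exact HF]. destruct Hu as (y & Hy & ->). auto.
  - exact HS.
  - intros u Hu. apply in_image in Hu; [|exact HF]. destruct Hu as (y & Hy & ->).
    rewrite inverse_eq; auto.
  - intros y Hy. exists (F y). rewrite inverse_eq by auto. split; [|reflexivity].
    apply in_image; [exact HF|]. exists y. auto.
  - intros u v Hu Hv. apply in_image in Hu; [|exact HF]. apply in_image in Hv; [|exact HF].
    destruct Hu as (y & Hy & ->), Hv as (z & Hz & ->). rewrite !inverse_eq by auto.
    apply (increasing_reflects F S); auto.
Qed.

End OrderTypes.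

(** * Natural numbers and finite sets *)

Section Omega.
Context {M : structure} {hZF : ZF M} (w : M) (hw : IsOmega w).

Lemma omega_ord : Ordinal w.
Proof. apply hw. Qed.

Lemma omega_mem_ord (n : M) : n ∈ w -> Ordinal n.
Proof. apply ord_mem, omega_ord. Qed.

Lemma omega_succ (n : M) : n ∈ w -> succ n ∈ w.
Proof.
  intros Hn. destruct hw as [(_ & _ & H) _]. destruct (H n Hn) as (s & Hs & Hw).
  apply IsSucc_iff in Hs. subst s. exact Hw.
Qed.

Lemma omega_empty : empty ∈ w.
Proof.
  destruct hw as [(Ho & (y & Hy) & _) _].
  destruct (ord_subset empty w ord_empty Ho) as [H|H].
  - intros z []%in_empty.
  - exact H.
  - rewrite <- H in Hy. destruct (proj1 (in_empty y) Hy).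
Qed.

(** A nonempty [n] that is not a successor is closed under successors, hence a limit, and no member
    of ω is a limit. *)
Lemma omega_cases (n : M) : n ∈ w -> n = empty \/ exists m, m ∈ w /\ n = succ m.
Proof.
  intros Hn. assert (Ho := omega_mem_ord n Hn).
  destruct (classic (exists y, y ∈ n)) as [Hne|He].
  - right. apply NNPP. intros H. apply (proj2 hw n Hn).
    split; [exact Ho|]. split; [exact Hne|].
    intros y Hy. exists (succ y). split; [apply IsSucc_iff; reflexivity|].
    destruct (ord_subset (succ y) n) as [A|A]; auto.
    + apply ord_succ, (ord_mem n); auto.
    + apply ord_succ_subset; auto.
    + destruct H. exists y. split; [|auto]. exact (ord_trans w n y omega_ord Hn Hy).
  - left. apply ext. intros z. rewrite in_empty. firstorder.
Qed.

Lemma omega_ind (P : M -> Prop) : Dfn (fun rho => P (rho 0)) ->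
  P empty -> (forall n, n ∈ w -> P n -> P (succ n)) -> forall n, n ∈ w -> P n.
Proof.
  intros HP H0 HS n Hn.
  refine (ord_ind (fun n => n ∈ w -> P n) _ _ n (omega_mem_ord n Hn) Hn); [dfn|].
  clear n Hn. intros n _ IH Hn.
  destruct (omega_cases n Hn) as [->|(m & Hm & ->)]; [exact H0|].
  apply HS; [exact Hm|]. apply IH; [|exact Hm]. apply in_succ. auto.
Qed.

Lemma omega_unique (w' : M) : IsOmega w' -> w' = w.
Proof.
  intros hw'. destruct (ord_trichotomy w' w) as [H|[H|H]]; auto.
  - apply hw'.
  - apply hw.
  - destruct (proj2 hw w' H (proj1 hw')).
  - destruct (proj2 hw' w H (proj1 hw)).
Qed.

Lemma Finite_iff (x : M) : Finite x <-> exists n, n ∈ w /\ CardEq x n.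
Proof.
  split.
  - intros (w' & n & Hw' & H). rewrite (omega_unique w' Hw') in H. exists n. exact H.
  - intros (n & H). exists w, n. auto.
Qed.

Lemma Dfn_Finite : Dfn (fun rho : nat -> M => Finite (rho 0)).
Proof.
  apply (Dfn_iff _ (fun rho => exists n, n ∈ w /\ CardEq (rho 0) n)).
  - intros rho. apply Finite_iff.
  - dfn.
Qed.

Lemma CardEq_empty (x : M) : CardEq x empty -> x = empty.
Proof.
  intros (F & _ & Hm & _)%CardEq_elim. apply ext. intros z. rewrite in_empty.
  split; [|tauto]. intros Hz. apply (in_empty (F z)), Hm, Hz.
Qed.

(** The removed element [a] is the one that the bijection sends to the last element [n]; the
    assumption on [n] keeps this last element apart from the others. *)
Lemma CardEq_succ (x n : M) : CardEq x (succ n) -> n ∉ n ->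
  exists s a, a ∈ x /\ a ∉ s /\ CardEq s n /\ x = cup s (sing a).
Proof.
  intros (F & HF & Hm & Hi & Ho)%CardEq_elim Hn.
  destruct (Ho n) as (a & Ha & Ea); [apply in_succ; auto|].
  assert (Es : forall z, z ∈ sep x (fun z => z <> a) <-> z ∈ x /\ z <> a).
  { intros z. rewrite in_sep by dfn. reflexivity. }
  exists (sep x (fun z => z <> a)), a.
  split; [exact Ha|]. split; [rewrite Es; tauto|]. split.
  - apply (CardEq_intro _ _ F HF).
    + intros z [Hz Hza]%Es. destruct (proj1 (in_succ n (F z)) (Hm z Hz)) as [H|H]; [exact H|].
      destruct Hza. apply (Hi z a Hz Ha). congruence.
    + intros z z' [Hz _]%Es [Hz' _]%Es. apply Hi; auto.
    + intros y Hy. destruct (Ho y) as (z & Hz & ->); [apply in_succ; auto|].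
      exists z. split; [|reflexivity]. apply Es. split; [exact Hz|]. intros ->.
      apply Hn. rewrite Ea at 1. exact Hy.
  - apply ext. intros z. rewrite in_cup, in_sing, Es.
    destruct (classic (z = a)) as [->|]; tauto.
Qed.

Lemma Finite_empty : Finite (@empty M hZF).
Proof.
  apply Finite_iff. exists empty. split; [apply omega_empty|].
  apply (CardEq_intro _ _ (fun x => x)); [dfn | | |]; intros x; intros; [assumption..|].
  exists x. auto.
Qed.

Lemma Finite_add (s a : M) : Finite s -> Finite (cup s (sing a)).
Proof.
  intros Hs. destruct (classic (a ∈ s)) as [Ha|Ha].
  - replace (cup s (sing a)) with s; [exact Hs|]. apply ext. intros z.
    rewrite in_cup, in_sing. split; [tauto|]. intros [H| ->]; assumption.
  - apply Finite_iff in Hs. destruct Hs as (n & Hn & (F & HF & Hm & Hi & Ho)%CardEq_elim).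
    assert (Hnn : n ∉ n) by (apply ord_irrefl, omega_mem_ord, Hn).
    apply Finite_iff. exists (succ n). split; [apply omega_succ, Hn|].
    set (G := fun z => cond (z = a) n (F z)).
    assert (Ga : G a = n) by (apply cond_true; reflexivity).
    assert (Gs : forall z, z ∈ s -> G z = F z) by (intros z Hz; apply cond_false; congruence).
    apply (CardEq_intro _ _ G); [dfn | | |].
    + intros z. rewrite in_cup, in_sing, in_succ. intros [Hz| ->]; [|auto].
      rewrite Gs by exact Hz. auto.
    + intros z z'. rewrite !in_cup, !in_sing. intros [Hz| ->] [Hz'| ->].
      * rewrite !Gs by assumption. auto.
      * rewrite Ga, Gs by assumption. intros E. destruct Hnn. rewrite <- E at 1. auto.
      * rewrite Ga, Gs by assumption. intros E. destruct Hnn. rewrite E at 1. auto.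
      * reflexivity.
    + intros y. rewrite in_succ. intros [Hy| ->].
      * destruct (Ho y Hy) as (z & Hz & ->). exists z. rewrite in_cup, Gs; auto.
      * exists a. rewrite in_cup, in_sing, Ga. auto.
Qed.

Lemma Finite_ind (P : M -> Prop) : Dfn (fun rho => P (rho 0)) ->
  P empty -> (forall s a, P s -> P (cup s (sing a))) -> forall s, Finite s -> P s.
Proof.
  intros HP H0 HS s Hs. apply Finite_iff in Hs. destruct Hs as (n & Hn & Hs).
  revert s Hs. refine (omega_ind (fun n => forall s, CardEq s n -> P s) _ _ _ n Hn).
  - dfn.
  - intros s ->%CardEq_empty. exact H0.
  - clear n Hn. intros n Hn IH s Hs.
    destruct (CardEq_succ s n Hs) as (s' & a & _ & _ & Hs' & ->).
    + apply ord_irrefl, omega_mem_ord, Hn.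
    + apply HS, IH, Hs'.
Qed.

Lemma Finite_sing (a : M) : Finite (sing a).
Proof.
  replace (sing a) with (cup empty (sing a)); [apply Finite_add, Finite_empty|].
  apply ext. intros z. rewrite in_cup, in_empty. tauto.
Qed.

Lemma Finite_upair (a b : M) : Finite (upair a b).
Proof.
  replace (upair a b) with (cup (sing a) (sing b)); [apply Finite_add, Finite_sing|].
  apply ext. intros z. rewrite in_cup, !in_sing, in_upair. reflexivity.
Qed.

Lemma Finite_Subset (s t : M) : Finite s -> Subset t s -> Finite t.
Proof.
  intros Hs. revert t.
  refine (Finite_ind (fun s => forall t, Subset t s -> Finite t) _ _ _ s Hs).
  - apply Dfn_all. apply Dfn_imp; [dfn|]. apply (Dfn_rel1 Finite Dfn_Finite). dfn.
  - intros t Ht. replace t with (@empty M hZF); [apply Finite_empty|].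
    apply ext. intros z. rewrite in_empty. split; [tauto|]. intros Hz.
    apply (in_empty z), Ht, Hz.
  - clear s Hs. intros s a IH t Ht.
    assert (Es : forall z, z ∈ sep t (fun z => z ∈ s) <-> z ∈ t /\ z ∈ s).
    { intros z. rewrite in_sep by dfn. reflexivity. }
    assert (Hf : Finite (sep t (fun z => z ∈ s))) by (apply IH; intros z; rewrite Es; tauto).
    assert (H : forall z, z ∈ t -> z ∈ s \/ z = a).
    { intros z Hz. apply Ht in Hz. rewrite in_cup, in_sing in Hz. exact Hz. }
    destruct (classic (a ∈ t)) as [Ha|Ha].
    + replace t with (cup (sep t (fun z => z ∈ s)) (sing a)); [apply Finite_add, Hf|].
      apply ext. intros z. rewrite in_cup, in_sing, Es. split.
      * intros [[Hz _]| ->]; assumption.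
      * intros Hz. destruct (H z Hz); auto.
    + replace t with (sep t (fun z => z ∈ s)); [exact Hf|].
      apply ext. intros z. rewrite Es. split; [tauto|]. intros Hz.
      destruct (H z Hz) as [|Ez]; [tauto|]. rewrite Ez in Hz. tauto.
Qed.

End Omega.

(** * The first uncountable cardinal *)

Section Omega1.
Context {M : structure} {hZF : ZF M} (w k : M) (hw : IsOmega w) (hk : IsOmega1 k).

Lemma omega1_ord : Ordinal k.
Proof. destruct hk as (w' & _ & [H _] & _). exact H. Qed.

Lemma omega_in_omega1 : w ∈ k.
Proof. destruct hk as (w' & Hw & _ & H & _). rewrite (omega_unique w hw w' Hw) in H. exact H. Qed.

Lemma omega1_mem_ord (x : M) : x ∈ k -> Ordinal x.
Proof. apply ord_mem, omega1_ord. Qed.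

Lemma omega_subset_omega1 (n : M) : n ∈ w -> n ∈ k.
Proof. apply (ord_trans k w n omega1_ord omega_in_omega1). Qed.

Lemma empty_in_omega1 : empty ∈ k.
Proof. apply omega_subset_omega1, omega_empty, hw. Qed.

(** The least ordinal equinumerous with [b] is a cardinal below ω₁, so ω does not belong to it. *)
Lemma omega1_mem_countable (b : M) : b ∈ k -> CardLe b w.
Proof.
  intros Hb. assert (Ho := omega1_mem_ord b Hb).
  destruct (ord_min (fun c => CardEq b c) b) as (c & Hc & Hbc & Hcb & Hmin);
    [dfn | exact Ho | apply CardEq_refl |].
  assert (Hck : c ∈ k).
  { destruct Hcb as [H| ->]; [exact (ord_trans k b c omega1_ord Hb H) | exact Hb]. }
  assert (Hwc : w ∉ c).
  { destruct hk as (w' & Hw & _ & _ & H). rewrite (omega_unique w hw w' Hw) in H.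
    apply H; [exact Hck|]. split; [exact Hc|]. intros a Ha Hac.
    apply (Hmin a Ha). exact (CardEq_trans b c a Hbc (CardEq_sym a c Hac)). }
  apply (CardLe_trans b c w (CardEq_CardLe b c Hbc)).
  apply CardLe_Subset, ord_not_mem; auto. apply omega_ord, hw.
Qed.

(** The image of an injection into ω has order type at most ω, so [k] would be equinumerous with an
    ordinal below itself. *)
Lemma omega1_uncountable : ~ CardLe k w.
Proof.
  intros (F & HF & Hm & Hi)%CardLe_elim.
  assert (HS : Subset (image k F) w).
  { intros y. rewrite in_image by exact HF. intros (x & Hx & ->). auto. }
  destruct (order_type_exists (image k F)) as [t Ht].
  { intros y Hy. apply (omega_mem_ord w hw), HS, Hy. }
  assert (Htk : t ∈ k).
  { destruct (order_type_bound _ _ _ Ht (omega_ord w hw) HS) as [H| ->].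
    - apply omega_subset_omega1, H.
    - apply omega_in_omega1. }
  destruct hk as (w' & _ & [_ Hc] & _). apply (Hc t Htk).
  apply (CardEq_trans _ (image k F)); [apply HasOrderType_CardEq, Ht|].
  apply CardEq_sym, (CardEq_intro _ _ F HF); auto.
  - intros x Hx. apply in_image; [exact HF|]. exists x. auto.
  - intros y Hy. apply in_image in Hy; assumption.
Qed.

Lemma not_CardLe_omega1_mem (c h : M) : c ∈ k -> Subset h c -> ~ CardLe k h.
Proof.
  intros Hc Hh H. apply omega1_uncountable.
  apply (CardLe_trans k h w H). apply (CardLe_trans h c w); [apply CardLe_Subset, Hh|].
  apply omega1_mem_countable, Hc.
Qed.

Lemma omega1_succ (a : M) : a ∈ k -> succ a ∈ k.
Proof.
  intros Ha. assert (Ho := omega1_mem_ord a Ha).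
  destruct (ord_subset (succ a) k) as [H|E]; auto.
  - apply ord_succ, Ho.
  - apply omega1_ord.
  - apply ord_succ_subset; [apply omega1_ord | exact Ha].
  - destruct omega1_uncountable. rewrite <- E.
    destruct (CardLe_elim _ _ (omega1_mem_countable a Ha)) as (F & HF & Hm & Hi).
    (* Shifting the injection of [a] by one frees the value 0 for the new element [a]. *)
    set (G := fun z => cond (z = a) empty (succ (F z))).
    assert (Ga : G a = empty) by (apply cond_true; reflexivity).
    assert (Gs : forall z, z ∈ a -> G z = succ (F z)).
    { intros z Hz. apply cond_false. intros ->. exact (ord_irrefl a Ho Hz). }
    apply (CardLe_intro _ _ G); [dfn | |].
    + intros z [Hz| ->]%in_succ.
      * rewrite Gs by exact Hz. apply omega_succ; auto.
      * rewrite Ga. apply omega_empty, hw.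
    + intros z z' [Hz| ->]%in_succ [Hz'| ->]%in_succ; rewrite ?Ga, ?Gs by assumption.
      * intros E'. apply Hi; auto. apply succ_inj; auto; apply (omega_mem_ord w hw); auto.
      * intros E'. symmetry in E'. destruct (empty_neq_succ _ E').
      * intros E'. destruct (empty_neq_succ _ E').
      * reflexivity.
Qed.

Lemma omega1_join (a b : M) : a ∈ k -> b ∈ k -> exists c, c ∈ k /\ Subset a c /\ Subset b c.
Proof.
  intros Ha Hb. assert (Hao := omega1_mem_ord a Ha). assert (Hbo := omega1_mem_ord b Hb).
  destruct (ord_trichotomy a b Hao Hbo) as [H|[->|H]].
  - exists b. split; [exact Hb|]. split; [apply Hbo, H | intros z; auto].
  - exists b. split; [exact Hb|]. split; intros z; auto.
  - exists a. split; [exact Ha|]. split; [intros z; auto | apply Hao, H].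
Qed.

(** * Regularity, and the failure of each principle without it *)

Definition regular : Prop := forall b, b ∈ k -> ~ HasCofinalMap b k.

Lemma IsCf_regular : IsCf k k <-> regular.
Proof.
  split.
  - intros (_ & _ & H). exact H.
  - intros H. split; [apply omega1_ord|]. split; [|exact H].
    exists (lam k (fun x => x)). split; [apply IsFun_lam; [dfn | auto]|].
    intros x Hx. exists x, x. rewrite Maps_lam by dfn. auto.
Qed.

(** [K x] is the least [n] such that [x] lies below the [n]-th term of a
    cofinal sequence of length ω. *)
Lemma singular_index : ~ regular -> exists K, DF K /\ maps_to K k w /\
  (forall x y, x ∈ k -> y ∈ k -> x ∈ y -> K x = K y \/ K x ∈ K y) /\
  (forall n, n ∈ w -> exists c, c ∈ k /\ forall x, x ∈ k -> K x = n -> x ∈ c).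
Proof.
  intros Hr. apply not_all_ex_not in Hr. destruct Hr as [b Hr].
  apply imply_to_and in Hr. destruct Hr as [Hb Hr]. apply NNPP in Hr.
  destruct Hr as (g & Hg & Hcof).
  (* This injection re-indexes the cofinal map by natural numbers, so that every [x] has a least
     index; its injectivity later bounds the fibre over [e i] by [succ (app g i)]. *)
  destruct (CardLe_elim _ _ (omega1_mem_countable b Hb)) as (e & He & em & ei).
  set (R := fun x n => n ∈ w /\ exists i, i ∈ b /\ e i = n /\ (x ∈ app g i \/ x = app g i)).
  assert (DR : Dfn (fun rho => R (rho 0) (rho 1))) by (unfold R; dfn).
  assert (Rw : forall x n, R x n -> Ordinal n).
  { intros x n [Hn _]. exact (omega_mem_ord w hw n Hn). }
  destruct (DF_of_graph (fun x n => R x n /\ forall m, m ∈ n -> ~ R x m)) as (K & HK & EK).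
  { dfn. }
  { intros x m n [Hm Mm] [Hn Mn].
    destruct (ord_trichotomy m n (Rw x m Hm) (Rw x n Hn)) as [H|[H|H]]; auto.
    - destruct (Mn m H Hm).
    - destruct (Mm n H Hn). }
  assert (SK : forall x, x ∈ k -> R x (K x) /\ forall m, m ∈ K x -> ~ R x m).
  { intros x Hx. destruct (Hcof x Hx) as (i & y & Hiy & Hxy).
    destruct (app_eq _ _ _ _ _ Hg Hiy) as (Hi & _ & ->).
    assert (Rx : R x (e i)) by (split; [apply em, Hi | exists i; auto]).
    destruct (ord_min (fun n => R x n) (e i)) as (n & _ & Rn & _ & Mn).
    - apply (Dfn_rel2 R DR (fun _ => x) (fun rho => rho 0) (Tm_const x) (Tm_var 0)).
    - exact (Rw x _ Rx).
    - exact Rx.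
    - rewrite (EK x n) by auto. auto. }
  exists K. split; [exact HK|]. split; [|split].
  - intros x Hx. apply (SK x Hx).
  - intros x y Hx Hy Hxy. destruct (SK x Hx) as [Rx Mx], (SK y Hy) as [Ry My].
    assert (Rxy : R x (K y)).
    { destruct Ry as (Hn & i & Hi & E & H). split; [exact Hn|]. exists i.
      split; [exact Hi|]. split; [exact E|]. left.
      assert (Hgi : Ordinal (app g i)) by apply omega1_mem_ord, (app_spec g b k i Hg Hi).
      destruct H as [H|H]; [exact (ord_trans _ y x Hgi H Hxy) | rewrite <- H; exact Hxy]. }
    destruct (ord_trichotomy (K x) (K y) (Rw _ _ Rx) (Rw _ _ Ry)) as [H|[H|H]]; auto.
    destruct (Mx (K y) H Rxy).
  - intros n Hn. destruct (classic (exists i, i ∈ b /\ e i = n)) as [(i & Hi & <-)|H].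
    + exists (succ (app g i)). split; [apply omega1_succ, (app_spec g b k i Hg Hi)|].
      intros x Hx E. destruct (SK x Hx) as ((_ & j & Hj & Ej & Hxj) & _).
      assert (j = i) as -> by (apply ei; auto; congruence).
      apply in_succ. exact Hxj.
    + exists empty. split; [apply empty_in_omega1|].
      intros x Hx E. destruct (SK x Hx) as ((_ & j & Hj & Ej & _) & _).
      destruct H. exists j. split; congruence.
Qed.

Lemma Arrow_regular : Arrow k k (succ w) -> regular.
Proof.
  intros HA. apply NNPP. intros (K & HK & Km & Kmono & Kfib)%singular_index.
  set (one := succ (@empty M hZF)).
  set (color := fun p => cond (exists x y, x ∈ p /\ y ∈ p /\ K x <> K y) one empty).
  assert (Hcolor : DF color) by dfn.
  assert (C : forall x y, K x = K y <-> color (upair x y) <> one).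
  { intros x y. unfold color. split.
    - intros E. rewrite cond_false; [apply empty_neq_succ|].
      intros (x' & y' & Hx & Hy & N). rewrite in_upair in *.
      destruct Hx as [->| ->], Hy as [->| ->]; congruence.
    - intros H. apply NNPP. intros N. apply H, cond_true.
      exists x, y. rewrite !in_upair. auto. }
  set (d := sep (power k) (fun p => exists x y, x ∈ k /\ y ∈ k /\ x <> y /\ p = upair x y)).
  assert (Hd : forall p, p ∈ d <-> exists x y, x ∈ k /\ y ∈ k /\ x <> y /\ p = upair x y).
  { intros p. unfold d. rewrite in_sep by dfn. split; [tauto|]. intros H. split; [|exact H].
    destruct H as (x & y & Hx & Hy & _ & ->). apply in_power. intros z.
    rewrite in_upair. intros [->| ->]; assumption. }
  assert (Hcol : forall x y i, Maps (lam d color) (upair x y) i -> color (upair x y) = i).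
  { intros x y i. rewrite Maps_lam by exact Hcolor. intros [_ ->]. reflexivity. }
  destruct (HA empty one (succ one) d (lam d color)) as [(h & Hh & Ht & Hc)|(h & Hh & Ht & Hc)].
  - apply IsEmpty_iff. reflexivity.
  - apply IsSucc_iff. reflexivity.
  - apply IsSucc_iff. reflexivity.
  - intros p. rewrite Hd. split; intros (x & y & H); exists x, y; rewrite IsUPair_iff in *; exact H.
  - apply IsFun_lam; [exact Hcolor|]. intros p _. apply in_succ. unfold color.
    destruct (classic (exists x y, x ∈ p /\ y ∈ p /\ K x <> K y)).
    + rewrite cond_true by assumption. auto.
    + rewrite cond_false by assumption. left. apply in_succ. auto.
  - apply HasOrderType_CardEq in Ht.
    destruct (CardEq_elim _ _ Ht) as (G & _ & Gm & _).
    (* The point [G w] is an arbitrary member of [h]; it serves to name the constant value of [K] on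
       [h]. *)
    assert (Hx0 := Gm w omega_in_omega1).
    destruct (Kfib (K (G w))) as (c & Hc' & Hfib); [apply Km, Hh, Hx0|].
    apply (not_CardLe_omega1_mem c h Hc'); [|apply CardEq_CardLe, Ht].
    intros x Hx. apply Hfib; [apply Hh, Hx|].
    destruct (classic (x = G w)) as [->|N]; [reflexivity|].
    apply C. rewrite (Hcol x (G w) empty).
    + apply empty_neq_succ.
    + apply (Hc x (G w)); auto. apply IsUPair_iff. reflexivity.
  - destruct (HasOrderType_elim _ _ Ht) as (Hs & G & HG & Gm & Gi & _ & Gmono).
    assert (Hw : w ∈ succ w) by (apply in_succ; auto).
    (* Along the enumeration of type ω + 1, [K] is nondecreasing and takes different values, so it
       increases strictly. Its value at index [w] would then not be in ω. *)
    apply (strictly_increasing_expansive (fun a => K (G a)) (succ w)) with w; auto.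
    + dfn.
    + intros a Ha. apply (omega_mem_ord w hw), Km, Hh, Gm, Ha.
    + intros a b Hab Hb. assert (Ha := ord_trans _ _ _ Hs Hb Hab).
      destruct (Kmono (G a) (G b)) as [E|E]; auto; try (apply Hh, Gm; assumption).
      apply C in E. destruct E. apply Hcol, (Hc (G a) (G b)); auto.
      * intros E. apply Gi in E; auto. subst b.
        apply (ord_irrefl a); [apply (ord_mem (succ w)); auto | exact Hab].
      * apply IsUPair_iff. reflexivity.
Qed.

Lemma Regressive_regular : Regressive k k -> regular.
Proof.
  intros HR. apply NNPP. intros (K & HK & Km & Kmono & Kfib)%singular_index.
  (* Only for [x] below ω can [K x] fail to lie below [x]. Sending those points to 0 adds at most
     [w] to a fibre, which stays bounded. *)
  set (F := fun x => cond (x ∈ w) empty (K x)).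
  assert (HF : DF F) by dfn.
  assert (F1 : forall x, x ∈ w -> F x = empty) by (intros; apply cond_true; assumption).
  assert (F2 : forall x, x ∉ w -> F x = K x) by (intros; apply cond_false; assumption).
  destruct (HR (lam k F)) as (a & preim & Ha & Hp & Hle).
  - apply IsFun_lam; [exact HF|]. intros x Hx. destruct (classic (x ∈ w)) as [H|H].
    + rewrite F1 by exact H. apply empty_in_omega1.
    + rewrite F2 by exact H. apply omega_subset_omega1, Km, Hx.
  - intros a b Ha Hne. rewrite Maps_lam by exact HF. intros [_ ->].
    assert (Hao := omega1_mem_ord a Ha).
    destruct (classic (a ∈ w)) as [H|H].
    + rewrite F1 by exact H. destruct (ord_subset empty a ord_empty Hao) as [A|A]; auto.
      * intros z []%in_empty.
      * destruct Hne. apply IsEmpty_iff. auto.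
    + rewrite F2 by exact H.
      apply (ord_not_mem a w Hao (omega_ord w hw) H), Km, Ha.
  - assert (Hp' : forall x, x ∈ preim -> x ∈ k /\ (x ∈ w \/ K x = a)).
    { intros x Hx. apply Hp in Hx. destruct Hx as [Hx HM]. split; [exact Hx|].
      apply Maps_lam in HM; [|exact HF]. destruct HM as [_ ->].
      destruct (classic (x ∈ w)); [auto|]. right. symmetry. auto. }
    destruct (classic (a ∈ w)) as [Haw|Haw].
    + destruct (Kfib a Haw) as (c & Hc & Hfib).
      destruct (omega1_join w c omega_in_omega1 Hc) as (e & He & Hwe & Hce).
      apply (not_CardLe_omega1_mem e preim He); [|exact Hle].
      intros x [Hx [Hxw|E]]%Hp'; [apply Hwe, Hxw | apply Hce; auto].
    + apply (not_CardLe_omega1_mem w preim omega_in_omega1); [|exact Hle].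
      intros x [Hx [Hxw|E]]%Hp'; [exact Hxw|]. destruct Haw. rewrite <- E. auto.
Qed.

Lemma DeltaArrow_regular : DeltaArrow k k -> regular.
Proof.
  intros HD. apply NNPP. intros (K & HK & Km & _ & Kfib)%singular_index.
  (* With this correction [L x ≤ x] holds throughout. Hence the union of the pair [A x] is [x],
     which makes [A] injective, and [L x] is the only natural number in [A x]. *)
  set (L := fun x => cond (x ∈ w) x (K x)).
  assert (L1 : forall x, x ∈ w -> L x = x) by (intros; apply cond_true; assumption).
  assert (L2 : forall x, x ∉ w -> L x = K x) by (intros; apply cond_false; assumption).
  assert (Lw : forall x, x ∈ k -> L x ∈ w).
  { intros x Hx. destruct (classic (x ∈ w)); [rewrite L1 | rewrite L2]; auto. }
  set (A := fun x => upair x (L x)).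
  assert (HA : DF A) by (unfold A, L; dfn).
  assert (UA : forall x, x ∈ k -> bigcup (A x) = x).
  { intros x Hx. assert (Hxo := omega1_mem_ord x Hx).
    assert (HL : Subset (L x) x).
    { destruct (classic (x ∈ w)) as [H|H].
      - rewrite L1 by exact H. intros z; auto.
      - apply Hxo, (ord_not_mem x w Hxo (omega_ord w hw) H), Lw, Hx. }
    apply ext. intros z. rewrite in_bigcup. unfold A. split.
    - intros (y & Hz & Hy). apply in_upair in Hy. destruct Hy as [->| ->]; auto.
    - intros Hz. exists x. rewrite in_upair. auto. }
  assert (Aw : forall x n, x ∈ k -> n ∈ w -> n ∈ A x -> n = L x).
  { intros x n Hx Hn [->|E]%in_upair; [symmetry; auto | exact E]. }
  assert (AL : forall x, L x ∈ A x) by (intros x; apply in_upair; auto).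
  destruct (HD (image k A)) as (B & HB & (D & HBD) & HBk).
  - intros a Ha. apply in_image in Ha; [|exact HA]. destruct Ha as (x & Hx & ->).
    split; [apply (Finite_upair w hw)|].
    intros z [->| ->]%in_upair; [apply omega1_mem_ord, Hx|].
    apply (omega_mem_ord w hw), Lw, Hx.
  - apply CardEq_sym, (CardEq_intro _ _ A HA).
    + intros x Hx. apply in_image; [exact HA|]. exists x. auto.
    + intros x y Hx Hy E. rewrite <- (UA x Hx), <- (UA y Hy), E. reflexivity.
    + intros y Hy. apply in_image in Hy; assumption.
  - apply CardEq_sym, CardEq_CardLe in HBk.
    assert (HBA : forall y, y ∈ B -> exists x, x ∈ k /\ y = A x).
    { intros y Hy. apply HB, in_image in Hy; assumption. }
    (* A natural number in the kernel would fix [L x] for all members of [B] and confine [x] to a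
       countable ordinal. Without one, different members have different [L x], and [B] injects into
       ω. *)
    destruct (classic (exists n, n ∈ w /\ n ∈ D)) as [(n & Hn & HnD)|Hno].
    + destruct (CardLe_elim _ _ HBk) as (F & _ & Fm & Fi).
      assert (HnB : forall y, y ∈ B -> n ∈ y).
      (* The kernel is tied to [y] only through a second member of [B]; one of [F empty] and [F w]
         provides it. *)
      { intros y Hy. assert (exists z, z ∈ B /\ y <> z) as (z & Hz & Hyz).
        { destruct (classic (y = F empty)) as [->|N].
          - exists (F w). split; [apply Fm, omega_in_omega1|]. intros E.
            apply Fi in E; [|apply empty_in_omega1 | apply omega_in_omega1].
            apply (in_empty empty). rewrite E at 2. apply omega_empty, hw.
          - exists (F empty). split; [apply Fm, empty_in_omega1 | exact N]. }
        apply (HBD y z Hy Hz Hyz n), HnD. }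
      destruct (Kfib n Hn) as (c & Hc & Hfib).
      destruct (omega1_join w c omega_in_omega1 Hc) as (e & He & Hwe & Hce).
      apply (not_CardLe_omega1_mem e e He); [intros z; auto|].
      apply (CardLe_trans k B e HBk), (CardLe_intro _ _ bigcup); [dfn | |].
      * intros y Hy. assert (Hny := HnB y Hy).
        destruct (HBA y Hy) as (x & Hx & ->). rewrite UA by exact Hx.
        assert (E := Aw x n Hx Hn Hny).
        destruct (classic (x ∈ w)) as [H|H]; [apply Hwe, H|].
        rewrite L2 in E by exact H. apply Hce. auto.
      * intros y y' Hy Hy'. destruct (HBA y Hy) as (x & Hx & ->), (HBA y' Hy') as (x' & Hx' & ->).
        rewrite !UA by assumption. congruence.
    + apply omega1_uncountable, (CardLe_trans k B w HBk).
      set (G := fun y => bigcup (sep y (fun z => z ∈ w))).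
      assert (HG : forall x, x ∈ k -> G (A x) = L x).
      { intros x Hx. apply ext. intros z. unfold G. rewrite in_bigcup. split.
        - intros (y & Hz & Hy). rewrite in_sep in Hy by dfn.
          rewrite <- (Aw x y); tauto.
        - intros Hz. exists (L x). rewrite in_sep by dfn. auto. }
      apply (CardLe_intro _ _ G); [unfold G; dfn | |].
      * intros y Hy. destruct (HBA y Hy) as (x & Hx & ->). rewrite HG; auto.
      * intros y y' Hy Hy' E. apply NNPP. intros N. apply Hno.
        destruct (HBA y Hy) as (x & Hx & ->), (HBA y' Hy') as (x' & Hx' & ->).
        rewrite !HG in E by assumption. exists (L x). split; [auto|].
        apply (HBD _ _ Hy Hy' N). split; [auto|]. rewrite E. auto.
Qed.

End Omega1.

(** * Consequences of regularity *)

Section Regular.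
Context {M : structure} {hZF : ZF M} (w k : M) (hw : IsOmega w) (hk : IsOmega1 k).
Context (hr : regular k).

(** * Small sets and their closure properties *)

Definition Small (X : M) : Prop :=
  forall f, IsFun f X k -> exists c, c ∈ k /\ forall x, x ∈ X -> app f x ∈ c.

Lemma Dfn_Small : Dfn (fun rho => Small (rho 0)).
Proof. unfold Small. dfn. Qed.

Lemma Small_bound (X : M) (F : M -> M) :
  Small X -> DF F -> maps_to F X k -> exists c, c ∈ k /\ forall x, x ∈ X -> F x ∈ c.
Proof.
  intros HX HF Hm. destruct (HX (lam X F)) as (c & Hc & H); [apply IsFun_lam; assumption|].
  exists c. split; [exact Hc|]. intros x Hx. rewrite <- (app_lam X F x HF Hx). auto.
Qed.

(** Regularity enters directly only here: by trichotomy, a map on [b] with no strict bound in ω₁ is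
    cofinal. *)
Lemma Small_mem (b : M) : b ∈ k -> Small b.
Proof.
  intros Hb f Hf. apply NNPP. intros H. apply (hr b Hb). exists f. split; [exact Hf|].
  intros x Hx. apply NNPP. intros N. apply H. exists x. split; [exact Hx|].
  intros i Hi. destruct (app_spec _ _ _ _ Hf Hi) as [Hfi Hk].
  destruct (ord_trichotomy x (app f i)) as [A|[A|A]]; auto.
  - apply (omega1_mem_ord k hk), Hx.
  - apply (omega1_mem_ord k hk), Hk.
  - destruct N. exists i, (app f i). auto.
  - destruct N. exists i, (app f i). auto.
Qed.

Lemma Small_Subset (X Y : M) : Small X -> Subset Y X -> Small Y.
Proof.
  intros HX HY f Hf.
  set (F := fun x => cond (x ∈ Y) (app f x) empty).
  assert (F1 : forall x, x ∈ Y -> F x = app f x) by (intros; apply cond_true; assumption).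
  destruct (Small_bound X F HX) as (c & Hc & H).
  - dfn.
  - intros x _. destruct (classic (x ∈ Y)) as [Hx|Hx].
    + rewrite F1 by exact Hx. apply (app_spec _ _ _ _ Hf Hx).
    + unfold F. rewrite cond_false by exact Hx. apply (empty_in_omega1 w k hw hk).
  - exists c. split; [exact Hc|]. intros x Hx. rewrite <- (F1 x Hx). auto.
Qed.

Lemma Small_image (X : M) (F : M -> M) : Small X -> DF F -> Small (image X F).
Proof.
  intros HX HF f Hf.
  assert (HI : forall x, x ∈ X -> F x ∈ image X F).
  { intros x Hx. apply in_image; [exact HF|]. exists x. auto. }
  destruct (Small_bound X (fun x => app f (F x)) HX) as (c & Hc & H).
  - dfn.
  - intros x Hx. apply (app_spec _ _ _ _ Hf (HI x Hx)).
  - exists c. split; [exact Hc|]. intros y Hy. apply in_image in Hy; [|exact HF].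
    destruct Hy as (x & Hx & ->). auto.
Qed.

Lemma ord_below (x c : M) : Ordinal x -> c ∈ k -> Subset x c -> x ∈ k.
Proof.
  intros Hx Hc H.
  destruct (ord_subset x c Hx (omega1_mem_ord k hk c Hc) H) as [A| ->]; [|exact Hc].
  exact (ord_trans k c x (omega1_ord k hk) Hc A).
Qed.

(** The supremum is a canonical bound, so that bounds can be assigned uniformly along a family and
    iterated. *)
Lemma Small_sup (X : M) (F : M -> M) :
  Small X -> DF F -> maps_to F X k -> bigcup (image X F) ∈ k.
Proof.
  intros HX HF Hm. destruct (Small_bound X F HX HF Hm) as (c & Hc & H).
  apply (ord_below _ c); [|exact Hc|].
  - apply ord_bigcup. intros y Hy. apply in_image in Hy; [|exact HF].
    destruct Hy as (x & Hx & ->). apply (omega1_mem_ord k hk), Hm, Hx.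
  - intros z Hz. apply in_bigcup in Hz. destruct Hz as (y & Hz & Hy).
    apply in_image in Hy; [|exact HF]. destruct Hy as (x & Hx & ->).
    exact (ord_trans c (F x) z (omega1_mem_ord k hk c Hc) (H x Hx) Hz).
Qed.

(** The suprema of a map on the pieces [B i] form a map on [I], which is bounded in turn. Successors
    are taken first, so that each supremum is a strict bound. *)
Lemma Small_bigcup (I : M) (B : M -> M) :
  Small I -> DF B -> (forall i, i ∈ I -> Small (B i)) -> Small (bigcup (image I B)).
Proof.
  intros HI HB HS f Hf.
  assert (HU : forall i x, i ∈ I -> x ∈ B i -> x ∈ bigcup (image I B)).
  { intros i x Hi Hx. apply in_bigcup. exists (B i). split; [exact Hx|].
    apply in_image; [exact HB|]. exists i. auto. }
  assert (Hs : forall i, i ∈ I -> maps_to (fun x => succ (app f x)) (B i) k).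
  { intros i Hi x Hx. apply (omega1_succ w k hw hk), (app_spec _ _ _ _ Hf (HU i x Hi Hx)). }
  assert (Ds : DF (fun x => succ (app f x))) by dfn.
  destruct (Small_bound I (fun i => bigcup (image (B i) (fun x => succ (app f x)))) HI)
    as (c & Hc & H).
  - dfn.
  - intros i Hi. apply Small_sup; auto.
  - exists c. split; [exact Hc|]. intros x Hx. apply in_bigcup in Hx.
    destruct Hx as (y & Hx & Hy). apply in_image in Hy; [|exact HB].
    destruct Hy as (i & Hi & ->).
    apply (ord_trans c (bigcup (image (B i) (fun x => succ (app f x)))));
      [apply (omega1_mem_ord k hk c Hc) | apply H, Hi |].
    apply in_bigcup. exists (succ (app f x)). split; [apply in_succ; auto|].
    apply in_image; [exact Ds|]. exists x. auto.
Qed.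

Lemma Small_CardEq (X Y : M) : Small X -> CardEq X Y -> Small Y.
Proof.
  intros HX (F & HF & _ & _ & Ho)%CardEq_elim.
  apply (Small_Subset (image X F)); [apply Small_image; assumption|].
  intros y Hy. apply in_image; [exact HF|]. apply Ho, Hy.
Qed.

Lemma Small_Finite (X : M) : Finite X -> Small X.
Proof.
  intros (n & Hn & H)%(Finite_iff w hw).
  apply (Small_CardEq n); [|apply CardEq_sym, H].
  apply Small_mem, (omega_subset_omega1 w k hw hk), Hn.
Qed.

Definition finite_subsets (X : M) : M := sep (power X) Finite.

Lemma in_finite_subsets (X s : M) : s ∈ finite_subsets X <-> Subset s X /\ Finite s.
Proof.
  unfold finite_subsets. rewrite in_sep, in_power by (apply (Dfn_Finite w hw)). reflexivity.
Qed.

Lemma DF_finite_subsets : DF finite_subsets.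
Proof.
  pose proof (Dfn_Finite w hw). unfold finite_subsets.
  apply (Tm_sep (fun rho => power (rho 0)) (fun x _ => Finite x)); dfn.
Qed.

(** Induction on the size: a subset with [succ n] elements arises from one with [n] elements by
    adding some [a ∈ X], so the sets [C (succ n)] are covered by an [X]-indexed union of images of
    [C n]. The last union is over ω, which is small. *)
Lemma Small_finite_subsets (X : M) : Small X -> Small (finite_subsets X).
Proof.
  intros HX. pose proof Dfn_Small.
  set (C := fun n => sep (power X) (fun s => CardEq s n)).
  assert (HC : DF C) by (unfold C; dfn).
  assert (EC : forall n s, s ∈ C n <-> Subset s X /\ CardEq s n).
  { intros n s. unfold C. rewrite in_sep, in_power by dfn. reflexivity. }
  apply (Small_Subset (bigcup (image w C))).
  - apply Small_bigcup; [apply Small_mem, (omega_in_omega1 w k hw hk) | exact HC |].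
    apply (omega_ind w hw (fun n => Small (C n))); [dfn | |].
    + apply (Small_Subset (sing empty)); [apply Small_Finite, (Finite_sing w hw)|].
      intros s Hs. apply in_sing, CardEq_empty, (EC empty), Hs.
    + intros n Hn IH.
      set (D := fun a => image (C n) (fun s => cup s (sing a))).
      assert (HD : DF D) by (unfold D; dfn).
      apply (Small_Subset (bigcup (image X D))).
      * apply Small_bigcup; auto. intros a _. apply Small_image; [exact IH | dfn].
      * intros s Hs. apply EC in Hs. destruct Hs as [Hs Hsn].
        destruct (CardEq_succ s n Hsn) as (t & a & Ha & _ & Ht & ->).
        { apply ord_irrefl, (omega_mem_ord w hw), Hn. }
        apply in_bigcup. exists (D a). split.
        -- unfold D. rewrite in_image by dfn. exists t. split; [|reflexivity].
           apply EC. split; [|exact Ht]. intros z Hz. apply Hs, in_cup. auto.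
        -- apply in_image; [exact HD|]. exists a. auto.
  - intros s Hs. apply in_finite_subsets in Hs. destruct Hs as [Hs Hf].
    apply (Finite_iff w hw) in Hf. destruct Hf as (n & Hn & Hsn).
    apply in_bigcup. exists (C n). split; [apply EC; auto|].
    apply in_image; [exact HC|]. exists n. auto.
Qed.

Lemma finite_subset_chain (C : M -> M) : DF C ->
  (forall m n, m ∈ n -> n ∈ w -> Subset (C m) (C n)) ->
  forall s, Finite s -> (forall z, z ∈ s -> exists n, n ∈ w /\ z ∈ C n) ->
  exists n, n ∈ w /\ Subset s (C n).
Proof.
  intros HC Hmono s Hs.
  refine (Finite_ind w hw (fun s => (forall z, z ∈ s -> exists n, n ∈ w /\ z ∈ C n) ->
    exists n, n ∈ w /\ Subset s (C n)) _ _ _ s Hs); [dfn | |].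
  - intros _. exists empty. split; [apply omega_empty, hw|]. intros z []%in_empty.
  - clear s Hs. intros s a IH H.
    destruct IH as (m & Hm & Hsm); [intros z Hz; apply H, in_cup; auto|].
    destruct (H a) as (n & Hn & Han); [apply in_cup; rewrite in_sing; auto|].
    destruct (ord_trichotomy m n) as [A|[A|A]];
      [apply (omega_mem_ord w hw); assumption.. | | |].
    + exists n. split; [exact Hn|]. intros z Hz. rewrite in_cup, in_sing in Hz.
      destruct Hz as [Hz| ->]; [|exact Han]. apply (Hmono m n A Hn), Hsm, Hz.
    + exists n. split; [exact Hn|]. intros z Hz. rewrite in_cup, in_sing in Hz.
      destruct Hz as [Hz| ->]; [|exact Han]. rewrite <- A. apply Hsm, Hz.
    + exists m. split; [exact Hm|]. intros z Hz. rewrite in_cup, in_sing in Hz.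
      destruct Hz as [Hz| ->]; [apply Hsm, Hz|]. apply (Hmono n m A Hm), Han.
Qed.

(** If all fibres were bounded, then, the finite subsets of a small set being
    few, iterating ω times a bound on the fibres would lead to a [beta] at which
    [F beta] is a finite subset of an earlier stage, so that [beta < beta]. *)
Lemma pressing_down (B F : M -> M) : DF B -> DF F ->
  (forall c, c ∈ k -> Small (B c)) ->
  (forall a, a ∈ k -> Finite (F a) /\ forall z, z ∈ F a -> exists c, c ∈ a /\ z ∈ B c) ->
  exists s, forall c, c ∈ k -> exists a, a ∈ k /\ F a = s /\ a ∉ c.
Proof.
  intros HB HF SB FB. apply NNPP. intros Hno.
  assert (Hbd : forall s, exists c, c ∈ k /\ forall a, a ∈ k -> F a = s -> a ∈ c).
  { intros s. apply NNPP. intros H. apply Hno. exists s. intros c Hc. apply NNPP. intros H'.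
    apply H. exists c. split; [exact Hc|]. intros a Ha E. apply NNPP. intros N.
    apply H'. exists a. auto. }
  pose proof (omega1_ord k hk) as Hko. pose proof (omega1_mem_ord k hk) as Hmo.
  pose proof DF_finite_subsets as HFS.
  assert (Dsucc : DF (@succ M hZF)) by dfn.
  (* The strict supremum of the fibre over [s]; the successors place each point of the fibre inside
     it. *)
  set (g := fun s => bigcup (image (sep k (fun a => F a = s)) succ)).
  assert (Hg : DF g) by (unfold g; dfn).
  assert (Eg : forall s z, z ∈ g s <-> exists a, a ∈ k /\ F a = s /\ z ∈ succ a).
  { intros s z. unfold g. rewrite in_bigcup. split.
    - intros (y & Hz & Hy). apply in_image in Hy; [|exact Dsucc].
      destruct Hy as (a & Ha & ->). rewrite in_sep in Ha by dfn. exists a. tauto.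
    - intros (a & Ha & E & Hz). exists (succ a). split; [exact Hz|].
      apply in_image; [exact Dsucc|]. exists a. rewrite in_sep by dfn. auto. }
  assert (gk : forall s, g s ∈ k).
  { intros s. destruct (Hbd s) as (c & Hc & H). apply (ord_below _ c); [|exact Hc|].
    - apply ord_bigcup. intros y Hy. apply in_image in Hy; [|exact Dsucc].
      destruct Hy as (a & Ha & ->). rewrite in_sep in Ha by dfn. apply ord_succ, Hmo, Ha.
    - intros z Hz. apply Eg in Hz. destruct Hz as (a & Ha & E & Hz).
      apply (ord_succ_subset c a); auto. }
  set (U := fun a => bigcup (image a B)).
  assert (HU : DF U) by (unfold U; dfn).
  assert (EU : forall a z, z ∈ U a <-> exists c, c ∈ a /\ z ∈ B c).
  { intros a z. unfold U. rewrite in_bigcup. split.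
    - intros (y & Hz & Hy). apply in_image in Hy; [|exact HB].
      destruct Hy as (c & Hc & ->). exists c. auto.
    - intros (c & Hc & Hz). exists (B c). split; [exact Hz|].
      apply in_image; [exact HB|]. exists c. auto. }
  (* Every point of [k] whose [F]-value is a finite subset of the stage [U a] belongs to [G a]. *)
  set (G := fun a => bigcup (image (finite_subsets (U a)) g)).
  assert (HG : DF G) by (unfold G; dfn).
  assert (Gk : forall a, a ∈ k -> G a ∈ k).
  { intros a Ha. apply Small_sup; [|exact Hg | intros s _; apply gk].
    apply Small_finite_subsets, Small_bigcup; [apply Small_mem, Ha | exact HB |].
    intros c Hc. apply SB. exact (ord_trans k a c Hko Ha Hc). }
  (* The term [b n] is the supremum of [succ (G (b m))] over all [m < n]. Using all earlier terms
     makes the sequence monotone at once, and the successor puts [G (b n)] into [b (succ n)]. *)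
  destruct (recursion w (fun v => bigcup (image v (fun x => succ (G x))))) as (b & Hb & Eb);
    [dfn|].
  assert (DG : DF (fun x => succ (G x))) by dfn.
  assert (DGb : DF (fun m => succ (G (b m)))) by dfn.
  assert (Eb' : forall n z, n ∈ w -> z ∈ b n <-> exists m, m ∈ n /\ z ∈ succ (G (b m))).
  { intros n z Hn. rewrite (Eb n (omega_mem_ord w hw n Hn)), in_bigcup. split.
    - intros (y & Hz & Hy). apply in_image in Hy; [|exact DG]. destruct Hy as (x & Hx & ->).
      apply in_image in Hx; [|exact Hb]. destruct Hx as (m & Hm & ->).
      rewrite in_sep in Hm by dfn. exists m. tauto.
    - intros (m & Hm & Hz). exists (succ (G (b m))). split; [exact Hz|].
      apply in_image; [exact DG|]. exists (b m). split; [|reflexivity].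
      apply in_image; [exact Hb|]. exists m. rewrite in_sep by dfn.
      split; [|reflexivity]. split; [exact Hm|].
      exact (ord_trans w n m (omega_ord w hw) Hn Hm). }
  assert (bk : forall n, n ∈ w -> b n ∈ k).
  { intros n Hn.
    refine (ord_ind (fun n => n ∈ w -> b n ∈ k) _ _ n (omega_mem_ord w hw n Hn) Hn); [dfn|].
    clear n Hn. intros n _ IH Hn.
    replace (b n) with (bigcup (image n (fun m => succ (G (b m))))).
    - apply Small_sup; [|exact DGb|].
      + apply Small_mem, (omega_subset_omega1 w k hw hk), Hn.
      + intros m Hm. apply (omega1_succ w k hw hk), Gk, IH; [exact Hm|].
        exact (ord_trans w n m (omega_ord w hw) Hn Hm).
    - apply ext. intros z. rewrite (Eb' n z Hn), in_bigcup. split.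
      + intros (y & Hz & Hy). apply in_image in Hy; [|exact DGb].
        destruct Hy as (m & Hm & ->). exists m. auto.
      + intros (m & Hm & Hz). exists (succ (G (b m))). split; [exact Hz|].
        apply in_image; [exact DGb|]. exists m. auto. }
  set (beta := bigcup (image w b)).
  assert (Hbeta : beta ∈ k).
  { apply Small_sup; [|exact Hb | exact bk].
    apply Small_mem, (omega_in_omega1 w k hw hk). }
  assert (Ebeta : forall z, z ∈ beta <-> exists n, n ∈ w /\ z ∈ b n).
  { intros z. unfold beta. rewrite in_bigcup. split.
    - intros (y & Hz & Hy). apply in_image in Hy; [|exact Hb].
      destruct Hy as (n & Hn & ->). exists n. auto.
    - intros (n & Hn & Hz). exists (b n). split; [exact Hz|].
      apply in_image; [exact Hb|]. exists n. auto. }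
  destruct (FB beta Hbeta) as [Hfin Hsub].
  destruct (finite_subset_chain (fun n => U (b n))) with (s := F beta) as (n & Hn & HFn).
  - dfn.
  - intros m n Hmn Hn z Hz. apply EU in Hz. destruct Hz as (c & Hc & Hz).
    apply EU. exists c. split; [|exact Hz].
    apply Eb' in Hc; [|exact (ord_trans w n m (omega_ord w hw) Hn Hmn)].
    destruct Hc as (j & Hj & Hc). apply Eb'; [exact Hn|]. exists j. split; [|exact Hc].
    exact (ord_trans n m j (omega_mem_ord w hw n Hn) Hmn Hj).
  - exact Hfin.
  - intros z Hz. destruct (Hsub z Hz) as (c & Hc & Hzc). apply Ebeta in Hc.
    destruct Hc as (n & Hn & Hc). exists n. split; [exact Hn|]. apply EU. exists c. auto.
  (* The cycle is [beta ∈ g (F beta)], contained in [G (b n)], which is a member of [b (succ n)] and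
     so of [beta]. *)
  - apply (ord_irrefl beta); [apply Hmo, Hbeta|].
    apply (ord_trans beta (G (b n))).
    + apply Hmo, Hbeta.
    + apply Ebeta. exists (succ n). split; [apply omega_succ; assumption|].
      apply Eb'; [apply omega_succ; assumption|].
      exists n. split; apply in_succ; auto.
    + unfold G. apply in_bigcup. exists (g (F beta)). split.
      * apply Eg. exists beta. split; [exact Hbeta|]. split; [reflexivity|].
        apply in_succ. auto.
      * apply in_image; [exact Hg|]. exists (F beta). split; [|reflexivity].
        apply in_finite_subsets. auto.
Qed.

(** A shorter order type would be small, and the enumeration of [S] along it would be bounded. *)
Lemma unbounded_order_type (S : M) : Subset S k ->
  (forall c, c ∈ k -> exists a, a ∈ S /\ a ∉ c) -> HasOrderType S k.
Proof.
  intros HS HU. destruct (order_type_exists S) as [t Ht].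
  { intros x Hx. apply (omega1_mem_ord k hk), HS, Hx. }
  destruct (order_type_bound S t k Ht (omega1_ord k hk) HS) as [H|<-]; [|exact Ht].
  destruct (HasOrderType_elim _ _ Ht) as (_ & G & HG & Gm & _ & Go & _).
  destruct (Small_bound t G) as (c & Hc & Hb).
  - apply Small_mem, H.
  - exact HG.
  - intros a Ha. apply HS, Gm, Ha.
  - destruct (HU c Hc) as (x & Hx & N). destruct (Go x Hx) as (a & Ha & ->).
    destruct N. auto.
Qed.

Lemma fibre_order_type (F : M -> M) (s : M) : DF F ->
  (forall c, c ∈ k -> exists a, a ∈ k /\ F a = s /\ a ∉ c) ->
  HasOrderType (sep k (fun a => F a = s)) k.
Proof.
  intros HF H. apply unbounded_order_type.
  - intros a. rewrite in_sep by dfn. tauto.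
  - intros c Hc. destruct (H c Hc) as (a & Ha & E & N). exists a.
    rewrite in_sep by dfn. auto.
Qed.

Lemma Small_sing (a : M) : Small (sing a).
Proof. apply Small_Finite, (Finite_sing w hw). Qed.

(** * Regressive functions and Δ-systems under regularity *)

Lemma regular_Regressive : Regressive k k.
Proof.
  intros f Hf Hreg.
  (* Nothing lies below 0 to cover the value of [f] there, so the set assigned to 0 must be
     empty. *)
  set (F := fun a => cond (a = empty) empty (sing (app f a))).
  assert (F1 : F empty = empty) by (apply cond_true; reflexivity).
  assert (F2 : forall a, a <> empty -> F a = sing (app f a))
    by (intros; apply cond_false; assumption).
  assert (HF : DF F) by (unfold F; dfn).
  destruct (pressing_down sing F) as (s & Hs).
  - dfn.
  - exact HF.
  - intros c _. apply Small_sing.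
  - intros a Ha. destruct (classic (a = empty)) as [->|N].
    + rewrite F1. split; [apply (Finite_empty w hw)|]. intros z []%in_empty.
    + rewrite F2 by exact N. split; [apply (Finite_sing w hw)|].
      intros z ->%in_sing. exists (app f a). rewrite in_sing. split; [|reflexivity].
      apply (Hreg a); auto.
      * intros E. apply N, IsEmpty_iff, E.
      * apply (app_spec _ _ _ _ Hf Ha).
  (* A member of the fibre beyond 0 shows that [s] is a singleton; its element is the value
     sought. *)
  - destruct (Hs (succ empty)) as (a & Ha & E & N).
    { apply (omega1_succ w k hw hk), (empty_in_omega1 w k hw hk). }
    assert (Na : a <> empty) by (intros ->; apply N, in_succ; auto).
    rewrite (F2 a Na) in E.
    exists (app f a), (sep k (fun x => Maps f x (app f a))).
    split; [apply (app_spec _ _ _ _ Hf Ha)|].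
    split; [intros x; rewrite in_sep by dfn; reflexivity|].
    apply (CardLe_trans _ (sep k (fun a => F a = s))).
    + apply CardEq_CardLe, HasOrderType_CardEq, fibre_order_type; assumption.
    + apply CardLe_Subset. intros x. rewrite !in_sep by dfn. intros [Hx Ex].
      split; [exact Hx|].
      assert (Hax : app f a ∈ F x) by (rewrite Ex, <- E; apply in_sing; reflexivity).
      destruct (classic (x = empty)) as [->|Nx].
      * rewrite F1 in Hax. destruct (proj1 (in_empty _) Hax).
      * rewrite F2 in Hax by exact Nx. apply in_sing in Hax. rewrite Hax.
        apply (app_spec _ _ _ _ Hf Hx).
Qed.

Lemma regular_DeltaArrow : DeltaArrow k k.
Proof.
  intros A HA HAk.
  destruct (CardEq_elim _ _ (CardEq_sym _ _ HAk)) as (e & He & em & ei & _).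
  set (F := fun a => sep (e a) (fun z => exists c, c ∈ a /\ z ∈ e c)).
  assert (HF : DF F) by (unfold F; dfn).
  assert (EF : forall a z, z ∈ F a <-> z ∈ e a /\ exists c, c ∈ a /\ z ∈ e c).
  { intros a z. unfold F. rewrite in_sep by dfn. reflexivity. }
  destruct (pressing_down e F He HF) as (s & Hs).
  - intros c Hc. apply Small_Finite, HA, em, Hc.
  - intros a Ha. split; [|intros z; rewrite EF; tauto].
    apply (Finite_Subset w hw (e a)); [apply HA, em, Ha|]. intros z. rewrite EF. tauto.
  - set (S := sep k (fun a => F a = s)).
    assert (HS : forall a, a ∈ S <-> a ∈ k /\ F a = s).
    { intros a. unfold S. rewrite in_sep by dfn. reflexivity. }
    (* A point common to [e a] and [e b] with [a < b] is already covered when [b] is reached, so it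
       lies in [F b = s]; conversely [s] is part of both sets. *)
    assert (Hlt : forall a b z, a ∈ S -> b ∈ S -> a ∈ b -> z ∈ s <-> z ∈ e a /\ z ∈ e b).
    { intros a b z [Ha Ea]%HS [Hb Ebs]%HS Hab. split.
      - intros Hz. split; [rewrite <- Ea in Hz | rewrite <- Ebs in Hz]; apply EF in Hz; tauto.
      - intros [Hza Hzb]. rewrite <- Ebs. apply EF. split; [exact Hzb|]. exists a. auto. }
    exists (image S e). split; [|split].
    + intros y Hy. apply in_image in Hy; [|exact He]. destruct Hy as (a & Ha & ->).
      apply em, HS, Ha.
    + exists s. intros x y Hx Hy N z.
      apply in_image in Hx; [|exact He]. apply in_image in Hy; [|exact He].
      destruct Hx as (a & Ha & ->), Hy as (b & Hb & ->).
      destruct (ord_trichotomy a b) as [H|[->|H]].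
      * apply (omega1_mem_ord k hk), HS, Ha.
      * apply (omega1_mem_ord k hk), HS, Hb.
      * apply Hlt; assumption.
      * destruct N. reflexivity.
      * rewrite (Hlt b a z Hb Ha H). tauto.
    + apply CardEq_sym, (CardEq_trans _ S).
      * apply HasOrderType_CardEq, fibre_order_type; assumption.
      * apply (CardEq_intro _ _ e He).
        -- intros a Ha. apply in_image; [exact He|]. exists a. auto.
        -- intros a b Ha Hb. apply ei; apply HS; assumption.
        -- intros y Hy. apply in_image in Hy; assumption.
Qed.

(** * Greedy homogeneous sets and the partition relation *)

Definition greedy (E : M -> M -> Prop) (a s d : M) : Prop :=
  Subset s d /\ forall b, b ∈ d -> (b ∈ s <-> E b a /\ forall c, c ∈ s -> c ∈ b -> E c b).

Lemma greedy_coherent (E : M -> M -> Prop) (a s d s' d' : M) :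
  Ordinal d -> Ordinal d' -> greedy E a s d -> greedy E a s' d' ->
  forall b, Ordinal b -> b ∈ d -> b ∈ d' -> (b ∈ s <-> b ∈ s').
Proof.
  intros Hd Hd' [_ Hs] [_ Hs'].
  apply (ord_ind (fun b => b ∈ d -> b ∈ d' -> (b ∈ s <-> b ∈ s'))); [dfn|].
  intros b _ IH Hbd Hbd'. rewrite (Hs b Hbd), (Hs' b Hbd').
  split; intros [Hba H]; split; auto; intros c Hc Hcb;
    apply H; auto; apply (IH c Hcb);
    eauto using ord_trans.
Qed.

Lemma greedy_exists (E : M -> M -> Prop) (a : M) : Dfn (fun rho => E (rho 0) (rho 1)) ->
  forall d, Ordinal d -> exists s, greedy E a s d.
Proof.
  intros HE. apply (ord_ind (fun d => exists s, greedy E a s d)).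
  { unfold greedy. dfn. }
  intros d Hd IH.
  (* Greedy sets up to [b] exist by induction and agree by coherence, so quantifying over all of
     them replaces the choice of one. *)
  set (P := fun b => E b a /\ forall t, greedy E a t b -> forall c, c ∈ t -> E c b).
  assert (Es : forall b, b ∈ sep d P <-> b ∈ d /\ P b).
  { intros b. apply in_sep. unfold P, greedy. dfn. }
  exists (sep d P). split; [intros b; rewrite Es; tauto|].
  intros b Hb. assert (Hbo := ord_mem d b Hd Hb).
  assert (K : forall t c, greedy E a t b -> c ∈ b -> (c ∈ t <-> c ∈ sep d P)).
  { intros t c Ht Hcb. assert (Hco := ord_mem b c Hbo Hcb).
    rewrite Es. rewrite (proj2 Ht c Hcb).
    assert (Hcd := ord_trans d b c Hd Hb Hcb).
    split.
    - intros [Hca H]. split; [exact Hcd|]. split; [exact Hca|].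
      intros u Hu x Hx. apply H; [|apply (proj1 Hu), Hx].
      assert (Hxc : x ∈ c) by apply (proj1 Hu), Hx.
      apply (greedy_coherent E a u c t b Hco Hbo Hu Ht x); auto.
      + exact (ord_mem c x Hco Hxc).
      + exact (ord_trans b c x Hbo Hcb Hxc).
    - intros (_ & Hca & H). split; [exact Hca|]. intros x Hx Hxc.
      destruct (IH c Hcd) as [u Hu]. apply (H u Hu).
      apply (greedy_coherent E a t b u c Hbo Hco Ht Hu x); auto.
      + exact (ord_mem c x Hco Hxc).
      + exact (ord_trans b c x Hbo Hcb Hxc). }
  rewrite Es. split.
  - intros (_ & Hba & H). split; [exact Hba|]. intros c Hc Hcb.
    destruct (IH b Hb) as [t Ht]. apply (H t Ht). apply K; assumption.
  - intros [Hba H]. split; [exact Hb|]. split; [exact Hba|].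
    intros t Ht c Hc. assert (Hcb : c ∈ b) by apply (proj1 Ht), Hc.
    apply H; [|exact Hcb]. apply (K t c Ht Hcb), Hc.
Qed.

Lemma upair_comm (x y : M) : upair x y = upair y x.
Proof. apply ext. intros z. rewrite !in_upair. tauto. Qed.

Lemma ConstantOnPairs_intro (f h i : M) : (forall x, x ∈ h -> Ordinal x) ->
  (forall x y, x ∈ h -> y ∈ h -> x ∈ y -> Maps f (upair x y) i) -> ConstantOnPairs f h i.
Proof.
  intros Ho H x y p Hx Hy N Hp. apply IsUPair_iff in Hp. subst p.
  destruct (ord_trichotomy x y (Ho x Hx) (Ho y Hy)) as [A|[A|A]].
  - apply H; assumption.
  - contradiction.
  - rewrite upair_comm. apply H; assumption.
Qed.

Lemma regular_Arrow : Arrow k k (succ w).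
Proof.
  intros zero one two d f Hzero Hone Htwo Hd Hf.
  apply IsSucc_iff in Htwo. apply IsSucc_iff in Hone. apply IsEmpty_iff in Hzero. subst.
  set (one := succ (@empty M hZF)) in *.
  destruct (classic (exists h, Subset h k /\ HasOrderType h (succ w) /\ ConstantOnPairs f h one))
    as [H|Hno]; [right; exact H | left].
  set (E := fun x y => Maps f (upair x y) one).
  assert (HE : Dfn (fun rho => E (rho 0) (rho 1))) by (unfold E; dfn).
  (* The greedy set below [a] is unique, so this existential names it definably. *)
  set (T := fun a => sep a (fun b => exists s, greedy E a s a /\ b ∈ s)).
  assert (HT : DF T) by (unfold T, greedy; dfn).
  assert (GT : forall a, Ordinal a -> greedy E a (T a) a).
  { intros a Ha. destruct (greedy_exists E a HE a Ha) as [s Hs].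
    replace (T a) with s; [exact Hs|]. apply ext. intros b. unfold T.
    rewrite in_sep by (unfold greedy; dfn). split.
    - intros Hb. split; [apply Hs, Hb|]. exists s. auto.
    - intros (Hb & s' & Hs' & Hb').
      apply (greedy_coherent E a s a s' a Ha Ha Hs Hs' b); auto. exact (ord_mem a b Ha Hb). }
  assert (TE : forall a x y, Ordinal a -> x ∈ T a -> y ∈ T a -> x ∈ y -> E x y).
  { intros a x y Ha Hx Hy Hxy. destruct (GT a Ha) as [H1 H2].
    apply (H2 y (H1 y Hy)); assumption. }
  assert (TE' : forall a x, Ordinal a -> x ∈ T a -> E x a).
  { intros a x Ha Hx. destruct (GT a Ha) as [H1 H2]. apply (H2 x (H1 x Hx)), Hx. }
  assert (Tfin : forall a, a ∈ k -> Finite (T a)).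
  { intros a Hak. apply NNPP. intros Hinf. apply Hno.
    assert (Ha := omega1_mem_ord k hk a Hak).
    assert (To : forall x, x ∈ T a -> x ∈ a) by apply (GT a Ha).
    assert (Hak' : forall x, x ∈ a -> x ∈ k) by (intros x; apply (ord_trans k a x (omega1_ord k hk) Hak)).
    destruct (order_type_exists (T a)) as [t Ht].
    { intros x Hx. apply (ord_mem a); auto. }
    assert (Hwt : Subset w t).
    { apply ord_not_mem; [apply Ht | apply omega_ord, hw |]. intros Htw. apply Hinf.
      apply (Finite_iff w hw). exists t. split; [exact Htw|].
      apply CardEq_sym, HasOrderType_CardEq, Ht. }
    destruct (HasOrderType_elim _ _ Ht) as (Hto & G & HG & Gm & _ & _ & Gi).
    (* [T a] may be longer than ω; its first ω elements, with [a] on top, have type ω + 1. *)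
    set (h := cup (image w G) (sing a)).
    assert (Hh : forall x, x ∈ h <-> (exists n, n ∈ w /\ x = G n) \/ x = a).
    { intros x. unfold h. rewrite in_cup, in_sing, in_image by exact HG. reflexivity. }
    assert (HhT : forall x, x ∈ h -> x ∈ T a \/ x = a).
    { intros x [(n & Hn & ->)| ->]%Hh; auto. }
    assert (Hhk : Subset h k) by (intros x [Hx| ->]%HhT; auto).
    assert (Hho : forall x, x ∈ h -> Ordinal x)
      by (intros x Hx; apply (omega1_mem_ord k hk), Hhk, Hx).
    exists h. split; [exact Hhk|]. split.
    - set (G' := fun n => cond (n = w) a (G n)).
      assert (G1 : G' w = a) by (apply cond_true; reflexivity).
      assert (G2 : forall n, n ∈ w -> G' n = G n).
      { intros n Hn. apply cond_false. intros ->. exact (ord_irrefl w (omega_ord w hw) Hn). }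
      apply (HasOrderType_intro h (succ w) G'); auto.
      + dfn.
      + apply ord_succ, omega_ord, hw.
      + intros n [Hn| ->]%in_succ; apply Hh; [rewrite G2 by exact Hn | rewrite G1]; [left|auto].
        exists n. auto.
      + intros x [(n & Hn & ->)| ->]%Hh.
        * exists n. rewrite in_succ, G2; auto.
        * exists w. rewrite in_succ, G1. auto.
      + intros m n [Hm| ->]%in_succ [Hn| ->]%in_succ Hmn.
        * rewrite !G2 by assumption. apply Gi; auto.
        * rewrite G1, G2 by assumption. auto.
        * destruct (ord_irrefl w (omega_ord w hw)). exact (ord_trans w n w (omega_ord w hw) Hn Hmn).
        * destruct (ord_irrefl w (omega_ord w hw) Hmn).
    - apply ConstantOnPairs_intro; [exact Hho|].
      intros x y [Hx| ->]%HhT [Hy| ->]%HhT Hxy.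
      + exact (TE a x y Ha Hx Hy Hxy).
      + exact (TE' a x Ha Hx).
      + destruct (ord_irrefl a Ha). exact (ord_trans a y a Ha (To y Hy) Hxy).
      + destruct (ord_irrefl a Ha Hxy). }
  destruct (pressing_down sing T) as (s & Hs); [dfn | exact HT | | |].
  - intros c _. apply Small_sing.
  - intros a Ha. split; [apply Tfin, Ha|]. intros z Hz. exists z. rewrite in_sing.
    split; [|reflexivity]. apply (GT a (omega1_mem_ord k hk a Ha)), Hz.
  - assert (HS : forall a, a ∈ sep k (fun a => T a = s) <-> a ∈ k /\ T a = s).
    { intros a. rewrite in_sep by dfn. reflexivity. }
    exists (sep k (fun a => T a = s)). split; [intros a; rewrite HS; tauto|].
    split; [apply fibre_order_type; assumption|].
    apply ConstantOnPairs_intro; [intros x Hx; apply (omega1_mem_ord k hk), HS, Hx|].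
    intros x y [Hx Ex]%HS [Hy Ey]%HS Hxy.
    assert (Hxo := omega1_mem_ord k hk x Hx). assert (Hyo := omega1_mem_ord k hk y Hy).
    assert (Hp : upair x y ∈ d).
    { apply Hd. exists x, y. rewrite IsUPair_iff. split; [exact Hx|]. split; [exact Hy|].
      split; [|reflexivity]. intros ->. exact (ord_irrefl y Hyo Hxy). }
    destruct (app_spec _ _ _ _ Hf Hp) as [HM Hv].
    rewrite in_succ in Hv. destruct Hv as [Hv|Hv].
    + unfold one in Hv. rewrite in_succ, in_empty in Hv. destruct Hv as [[]|Hv].
      rewrite Hv in HM. exact HM.
    (* Colour 1 would admit [x] into [T y], since all members of [T y = T x] are joined to [x]. But
       then [x] belongs to [T x], whose members lie below [x]. *)
    + destruct (ord_irrefl x Hxo). destruct (GT x Hxo) as [HTx _]. apply HTx.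
      rewrite Ex, <- Ey. destruct (GT y Hyo) as [_ HTy]. apply (HTy x Hxy).
      split; [unfold E; rewrite <- Hv; exact HM|].
      intros c Hc _. apply (TE' x c Hxo). rewrite Ex, <- Ey. exact Hc.
Qed.

End Regular.

Theorem corollary1p3 (M : structure) (hZF : ZF M)
    (omega omega_plus_1 omega1 : M)
    (homega : IsOmega omega)
    (homegaS : IsSucc omega omega_plus_1)
    (homega1 : IsOmega1 omega1) :
  (IsCf omega1 omega1 <-> Arrow omega1 omega1 omega_plus_1) /\
  (Arrow omega1 omega1 omega_plus_1 <-> Regressive omega1 omega1) /\
  (Regressive omega1 omega1 <-> DeltaArrow omega1 omega1).
Proof.
  apply IsSucc_iff in homegaS. subst omega_plus_1.
  rewrite (IsCf_regular omega1 homega1).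
  pose proof (Arrow_regular omega omega1 homega homega1).
  pose proof (Regressive_regular omega omega1 homega homega1).
  pose proof (DeltaArrow_regular omega omega1 homega homega1).
  pose proof (regular_Arrow omega omega1 homega homega1).
  pose proof (regular_Regressive omega omega1 homega homega1).
  pose proof (regular_DeltaArrow omega omega1 homega homega1).
  tauto.
Qed.
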